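(* Let $d\ge 3$, $\kappa\ge 1$, and let $(a(e);e\in\mathbb L^d)$ be i.i.d. random conductances on the edges of $\mathbb Z^d$ with $\kappa^{-1}\le a(e)\le\kappa$ almost surely. Let $f_N=N^2\lambda_N$, where $\lambda_N$ is the lowest Dirichlet eigenvalue of the associated random walk on $Q_N=\{1,\dots,N\}^d$ (defined in the context). Then there is a constant $C<\infty$ which depends only on $d$ and $\kappa$ such that for all $t>0$ and $N\ge1$, $$\mathbb P\big(|f_N-\mathbb E f_N|\ge tN^{(2-d)/2}\big)\le 4\exp(-t/C)$$ and $$\mathrm{Var}(f_N)\le C N^{2-d}.$$
   Context: $\mathbb L^d$ is the set of nearest-neighbour edges of $\mathbb Z^d$; $x\sim y$ means $|x-y|=1$ (Euclidean norm); $a(x,y)=a(y,x)$ is the conductance of the edge with endpoints $x\sim y$; $a(x)=\sum_{y\sim x}a(x,y)$. $\mathbb P$ is the law of the conductances, with expectation $\mathbb E$ and variance $\mathrm{Var}$. $Q_N=\{1,\dots,N\}^d$, $\overline Q_N=\{0,\dots,N+1\}^d$, $\partial Q_N=\overline Q_N\setminus Q_N$. $\mathcal H_{N,0}=\{u:\overline Q_N\to\mathbb R;\ u=0\text{ on }\partial Q_N\}$, $\|u\|_{2,N}^2=\sum_{x\in Q_N}u(x)^2a(x)$, and $\mathcal E_N(u,v)=\sum a(x,y)(u(x)-u(y))(v(x)-v(y))$, the sum being over edges $\{x,y\}$ with $x\in Q_N$, $y\in\overline Q_N$, $x\sim y$, each edge counted once. $\lambda_N=\inf\{\mathcal E_N(u,u):u\in\mathcal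 H_{N,0},\ \|u\|_{2,N}=1\}$; equivalently, $\lambda_N>0$ is the smallest eigenvalue of $Hu(x)=u(x)-\sum_{y\sim x}\frac{a(x,y)}{a(x)}u(y)$, $x\in Q_N$, acting on $\mathcal H_{N,0}$. *)

(* Defs.v *)
From HB Require Import structures.
From mathcomp Require Import all_boot all_order all_algebra finmap.
From mathcomp Require Import all_classical all_reals all_analysis.

Set Implicit Arguments.
Unset Strict Implicit.
Unset Printing Implicit Defensive.

Import Order.TTheory GRing.Theory Num.Theory.
Import numFieldNormedType.Exports.

Local Open Scope classical_set_scope.
Local Open Scope ring_scope.

Definition site (d : nat) := {ffun 'I_d -> int}.

(* x ~ y, i.e. |x - y| = 1; the Euclidean norm is squared to stay in int. *)
Definition nn (d : nat) (x y : site d) : bool :=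
  \sum_(i < d) (x i - y i) ^+ 2 == 1.

(* The edge with endpoints x and y. *)
Definition edge (d : nat) (x y : site d) : {fset site d} := [fset x; y]%fset.

Definition lattice_edges (d : nat) : set {fset site d} :=
  [set e | exists x y : site d, nn x y /\ e = edge x y].

(* Conductances are total functions on {fset site d}; only their values on
   [lattice_edges d] are ever used or constrained. *)
Definition environment (d : nat) (R : realType) := {fset site d} -> R.

Definition site_weight (d : nat) (R : realType) (c : environment d R)
    (x : site d) : R :=
  \sum_(y \in [set y | nn x y]) c (edge x y).

(* A finitely supported sum over an infinite set is 0 by convention; this is
   why that convention plays no role in [site_weight]. *)
Lemma finite_nn (d : nat) (x : site d) : finite_set [set y | nn x y].
Proof.
pose shift (k : {ffun 'I_d -> 'I_3}) : site d :=
  [ffun i => x i + (k i)%:Z - 1].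
apply: (@sub_finite_set _ _ (shift @` setT)); last first.
  by apply: finite_image; exact: finite_finset.
move=> y /= /eqP xy1.
have bnd i : `|y i - x i| <= 1.
  have le1 : (x i - y i) ^+ 2 <= 1.
    by rewrite -xy1 (bigD1 i)//= lerDl sumr_ge0// => j _; exact: sqr_ge0.
  by rewrite distrC -(@ler_pXn2r _ 2%N)// ?nnegrE// expr1n real_normK ?num_real.
have pos i : 0 <= y i - x i + 1.
  by have := bnd i; rewrite ler_norml => /andP[+ _]; rewrite -subr_ge0 opprK.
exists [ffun i => inord (absz (y i - x i + 1))] => //.
apply/ffunP => i; rewrite !ffunE inordK.
  by rewrite gez0_abs ?pos// addrA addrK addrC subrK.
rewrite -ltz_nat gez0_abs ?pos// (le_lt_trans (y := 1 + 1))//.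
by rewrite lerD2r; have := bnd i; rewrite ler_norml => /andP[].
Qed.

(* The box {0, ..., N+1}^d. *)
Definition box (d N : nat) := {ffun 'I_d -> 'I_N.+2}.

Definition box_site (d N : nat) (x : box d N) : site d :=
  [ffun i => (x i : nat)%:Z].

(* x lies in {1, ..., N}^d. *)
Definition interior_box (d N : nat) (x : box d N) : bool :=
  [forall i, (0 < x i <= N)%N].

Definition dirichlet_space (d : nat) (R : realType) (N : nat)
    : set (box d N -> R) :=
  [set u | forall x, ~~ interior_box x -> u x = 0].

Definition norm2_sq (d : nat) (R : realType) (N : nat) (c : environment d R)
    (u : box d N -> R) : R :=
  \sum_(x : box d N | interior_box x) u x ^+ 2 * site_weight c (box_site x).

(* Every edge with an endpoint in {1, ..., N}^d arises from exactly two ordered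
   pairs of sites of the box; the factor 1/2 makes it count once. *)
Definition dirichlet_form (d : nat) (R : realType) (N : nat)
    (c : environment d R) (u v : box d N -> R) : R :=
  2^-1 * \sum_(x : box d N) \sum_(y : box d N |
            nn (box_site x) (box_site y) && (interior_box x || interior_box y))
      c (edge (box_site x) (box_site y)) * (u x - u y) * (v x - v y).

Definition principal_eigenvalue (d : nat) (R : realType) (N : nat)
    (c : environment d R) : R :=
  inf [set dirichlet_form c u u | u in
        [set u : box d N -> R | dirichlet_space u /\ norm2_sq c u = 1]].

Definition scaled_eigenvalue (d : nat) (R : realType) (disp : measure_display)
    (T : measurableType disp) (P : probability T R)
    (a : {fset site d} -> {RV P >-> R}) (N : nat) (w : T) : R :=
  N%:R ^+ 2 * principal_eigenvalue N (fun e => a e w).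

Section iid.
Context (disp : measure_display) (T : measurableType disp) (R : realType)
  (P : probability T R) (I : choiceType).

Definition mutually_independent (D : set I) (X : I -> {RV P >-> R}) : Prop :=
  forall (J : {fset I}) (B : I -> set R),
    [set` J] `<=` D -> (forall i, i \in J -> measurable (B i)) ->
    P (\bigcap_(i in [set` J]) (X i @^-1` B i)) =
    (\prod_(i <- J) P (X i @^-1` B i))%E.

Definition identically_distributed (D : set I) (X : I -> {RV P >-> R}) : Prop :=
  forall i j, D i -> D j -> forall B : set R, measurable B ->
    distribution P (X i) B = distribution P (X j) B.

Definition iid (D : set I) (X : I -> {RV P >-> R}) : Prop :=
  mutually_independent D X /\ identically_distributed D X.
End iid.

(* Main.v *)
Require Import Defs.
From HB Require Import structures.
From mathcomp Require Import all_boot all_order all_algebra finmap.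
From mathcomp Require Import all_classical all_reals all_analysis.
From mathcomp Require Import measurable_realfun ring lra zify.

Set Implicit Arguments.
Unset Strict Implicit.
Unset Printing Implicit Defensive.

Import Order.TTheory GRing.Theory Num.Theory.
Import numFieldNormedType.Exports.

Local Open Scope classical_set_scope.
Local Open Scope ring_scope.

(** The eigenvalue [lam] is a function of the finitely many conductances of the
    box, so the theorem is a concentration inequality for a function of
    independent variables. It follows from the Efron-Stein inequality once the
    one-sided influences of the conductances are known to satisfy, for every
    environment,
      [sum over e of (influence of e on N^2 lam)^2 <= K N^(2 - d)].

    Influences. Let [u >= 0] be a normalised minimiser of the Rayleigh quotient.
    Used as a test function after the conductance of one edge [e = {x, y}] has
    been changed, it shows that the eigenvalue increases by at most a constant
    times [(u x - u y)^2 + lam (u x^2 + u y^2)]. The sum of these quantities over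
    all edges is of order [lam <= C / N^2], and each of them is at most
    [C max u^2]. The point is thus the bound [max u^2 <= C / N^d]: squared
    influences of [N^2 lam] then sum to at most
    [C N^4 N^(-d) N^(-2) = C N^(2 - d)] (lemma [influences]).

    Maximum bound. Testing the eigenvalue equation against [u^(2p - 1)] gives
    [E(u^p, u^p) <= C p^2 lam |u|_{2p}^{2p}] for the Dirichlet form [E]. On the
    torus obtained by gluing opposite faces of the box, averaging
    [2 |v|_2^2 = |v - tau_h v|_2^2 + 2 <v, tau_h v>] over the shifts [tau_h]
    with [h] in a cube of side [l] yields the Nash-type inequality
      [|v|_2^2 <= C l^2 E(v, v) + l^(-d) |v|_1^2]
    (lemma [nash_box]). With [v = u^p] and [l] of order [N / p] the energy term
    is absorbed, whence
      [|u|_{2p}^{2p} <= C (p / N)^d (|u|_p^p)^2].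
    Iterating over [p = 2^k] gives the maximum bound (lemma
    [ground_state_bound]).

    Concentration. For a function [Z] of independent finitely valued variables
    whose upward influences have squares summing to at most [sigma^2], the
    Efron-Stein inequality gives [Var Z <= sigma^2], and applied to
    [exp (s Z)] it bounds [E exp (2 s Z)] by nearly [(E exp (s Z))^2]. Iterating
    from a tiny [s] gives exponential moments at scale [1 / sigma], hence
    exponential tails on both sides (lemmas [mgf_le] and [Ex_tail]).

    Transfer. Rounding each conductance to a fine grid changes [N^2 lam] by an
    arbitrarily small amount, almost surely, and turns all expectations into
    finite sums in which independence reads as a product of weights (lemma
    [integral_discretize]). The original variable is measurable because the
    infimum defining it may be taken over rational test functions (lemma
    [principal_eigenvalue_ratE]). *)

(** * Concentration on finite product spaces *)

Section FiniteProduct.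
Context (R : realType) (J V : finType) (p : J -> V -> R).
Hypothesis p_ge0 : forall i v, 0 <= p i v.
Hypothesis p_sum1 : forall i, \sum_v p i v = 1.

Local Notation Omega := {ffun J -> V}.
Implicit Types (w : Omega) (F G : Omega -> R) (i j : J).

Definition upd w i v : Omega := [ffun j => if j == i then v else w j].
Definition mass w : R := \prod_i p i (w i).
Definition Ex F : R := \sum_w mass w * F w.
Definition avg i F w : R := \sum_v p i v * F (upd w i v).
Definition avgs (s : seq J) F : Omega -> R := foldr avg F s.

(** Twice the conditional variance of [F] given all coordinates but [i], in the
    form of an average over two independent copies of that coordinate. *)
Definition vari i F w : R :=
  \sum_v \sum_v' p i v * p i v' * (F (upd w i v) - F (upd w i v')) ^+ 2.

Lemma upd_upd w i v v' : upd (upd w i v) i v' = upd w i v'.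
Proof. by apply/ffunP => j; rewrite !ffunE; case: eqP. Qed.

Lemma updC w i j v v' : i != j ->
  upd (upd w i v) j v' = upd (upd w j v') i v.
Proof.
move=> ij; apply/ffunP => k; rewrite !ffunE.
by case: (eqVneq k j) => // ->; rewrite eq_sym (negbTE ij).
Qed.

Lemma upd_id w i : upd w i (w i) = w.
Proof. by apply/ffunP => j; rewrite !ffunE; case: eqP => // ->. Qed.

Lemma mass_ge0 w : 0 <= mass w.
Proof. exact: prodr_ge0. Qed.

Lemma mass_sum1 : \sum_w mass w = 1.
Proof.
rewrite /mass -(bigA_distr_bigA (fun i v => p i v)) big1 // => i _.
Qed.

Lemma Ex_cst (c : R) : Ex (fun=> c) = c.
Proof. by rewrite /Ex -big_distrl /= mass_sum1 mul1r. Qed.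

Lemma Ex_le F G : (forall w, F w <= G w) -> Ex F <= Ex G.
Proof. by move=> FG; apply: ler_sum => w _; rewrite ler_wpM2l ?mass_ge0. Qed.

Lemma ExD F G : Ex (fun w => F w + G w) = Ex F + Ex G.
Proof. by rewrite /Ex -big_split; apply: eq_bigr => w _; rewrite mulrDr. Qed.

Lemma ExZ (c : R) F : Ex (fun w => c * F w) = c * Ex F.
Proof. by rewrite /Ex big_distrr; apply: eq_bigr => w _ /=; rewrite mulrCA. Qed.

Lemma Ex_sum (I : Type) (r : seq I) (F : I -> Omega -> R) :
  Ex (fun w => \sum_(k <- r) F k w) = \sum_(k <- r) Ex (F k).
Proof.
rewrite /Ex exchange_big; apply: eq_bigr => w _ /=.
by rewrite big_distrr.
Qed.

(** Exchanging the coordinate [w i] with the fresh value [v] is an involution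
    of the pairs [(w, v)] that preserves their weight. *)
Lemma Ex_avg i F : Ex (avg i F) = Ex F.
Proof.
have swapK : involutive (fun x : Omega * V => (upd x.1 i x.2, x.1 i)).
  by move=> [w v] /=; rewrite upd_upd upd_id ffunE eqxx.
transitivity (\sum_(x : Omega * V) mass x.1 * p i x.2 * F (upd x.1 i x.2)).
  rewrite -(pair_bigA _ (fun w v => mass w * p i v * F (upd w i v))) /=.
  by apply: eq_bigr => w _; rewrite big_distrr; apply: eq_bigr => v _ /=;
    rewrite mulrA.
rewrite (reindex_inj (inv_inj swapK)) /=.
transitivity (\sum_(x : Omega * V) mass x.1 * p i x.2 * F x.1).
  apply: eq_bigr => -[w v] _ /=; rewrite upd_upd upd_id; congr (_ * _).
  rewrite /mass (bigD1 i) //= [in RHS](bigD1 i) //= ffunE eqxx.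
  rewrite (eq_bigr (fun j => p j (w j))); first by ring.
  by move=> j /negbTE ji; rewrite ffunE ji.
rewrite -(pair_bigA _ (fun w v => mass w * p i v * F w)) /=.
apply: eq_bigr => w _; rewrite -(big_distrl (F w)) -big_distrr /=.
by rewrite p_sum1 mulr1.
Qed.

Lemma Ex_avgs s F : Ex (avgs s F) = Ex F.
Proof. by elim: s => //= i s IH; rewrite Ex_avg. Qed.

Lemma avg_le i F G : (forall w, F w <= G w) -> forall w, avg i F w <= avg i G w.
Proof. by move=> FG w; apply: ler_sum => v _; rewrite ler_wpM2l. Qed.

Lemma avgC i j F w : i != j -> avg i (avg j F) w = avg j (avg i F) w.
Proof.
move=> ij; rewrite /avg.
under eq_bigr do rewrite big_distrr /=.
rewrite exchange_big; apply: eq_bigr => v _; rewrite big_distrr /=.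
by apply: eq_bigr => v' _; rewrite mulrCA updC.
Qed.

Lemma avgs_avg i s F w : i \notin s -> avg i (avgs s F) w = avgs s (avg i F) w.
Proof.
elim: s w => //= j s IH w; rewrite inE negb_or => /andP[ij /IH{}IH].
rewrite avgC //; apply: eq_bigr => v _; congr (_ * _); exact: IH.
Qed.

Lemma avgs_supp s F w w' :
  (forall j, j \notin s -> w j = w' j) -> avgs s F w = avgs s F w'.
Proof.
elim: s w w' => [|i s IH] w w' ww' /=; first by congr F; apply/ffunP => j;
  exact: ww'.
apply: eq_bigr => v _; congr (_ * _); apply: IH => j js; rewrite !ffunE.
by case: eqVneq => // ji; apply: ww'; rewrite inE negb_or ji.
Qed.

Lemma avgs_enum F w : avgs (enum J) F w = Ex F.
Proof.
rewrite -(Ex_avgs (enum J)) -[LHS]Ex_cst; apply: eq_bigr => w' _.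
by congr (_ * _); apply: avgs_supp => j; rewrite mem_enum.
Qed.

Lemma variE i F w :
  vari i F w = 2 * (avg i (fun w => F w ^+ 2) w - avg i F w ^+ 2).
Proof.
pose f v := F (upd w i v).
have -> : vari i F w = \sum_v \sum_v' (p i v' * (p i v * f v ^+ 2) +
    p i v * (p i v' * f v' ^+ 2) - 2 * (p i v * f v) * (p i v' * f v')).
  by apply: eq_bigr => v _; apply: eq_bigr => v' _; rewrite /f; ring.
transitivity (\sum_v (p i v * f v ^+ 2 + p i v * avg i (fun w => F w ^+ 2) w
    - 2 * (p i v * f v) * avg i F w)).
  apply: eq_bigr => v _; rewrite sumrB big_split /= -big_distrl /= p_sum1 mul1r.
  by rewrite -!big_distrr.
rewrite sumrB big_split /= -!big_distrl -big_distrr /= p_sum1.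
by rewrite /avg -/f; ring.
Qed.

Lemma avg_jensen i F w : avg i F w ^+ 2 <= avg i (fun w => F w ^+ 2) w.
Proof.
rewrite -subr_ge0 -(pmulr_rge0 _ (ltr0n R 2)) -variE.
apply: sumr_ge0 => v _; apply: sumr_ge0 => v' _.
by apply: mulr_ge0; [exact: mulr_ge0 | exact: sqr_ge0].
Qed.

(** Averaging over another coordinate commutes with the resampling of [i], so
    Jensen's inequality applies to each squared increment. *)
Lemma vari_avg i j F w : i != j -> vari i (avg j F) w <= avg j (vari i F) w.
Proof.
move=> ij; rewrite /vari.
have -> : avg j (vari i F) w = \sum_v \sum_v' p i v * p i v' *
    avg j (fun w => (F (upd w i v) - F (upd w i v')) ^+ 2) w.
  rewrite /avg /vari; under eq_bigr do rewrite big_distrr /=.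
  rewrite exchange_big; apply: eq_bigr => v _.
  under eq_bigr do rewrite big_distrr /=.
  rewrite exchange_big; apply: eq_bigr => v' _; rewrite big_distrr /=.
  by apply: eq_bigr => z _; rewrite mulrCA.
apply: ler_sum => v _; apply: ler_sum => v' _; rewrite ler_wpM2l ?mulr_ge0 //.
apply: le_trans (avg_jensen _ _ _); rewrite le_eqVlt; apply/orP; left;
  apply/eqP.
congr (_ ^+ 2); rewrite /avg -sumrB; apply: eq_bigr => z _.
by rewrite mulrBr !(@updC _ i j).
Qed.

Lemma vari_avgs i s F w : i \notin s -> vari i (avgs s F) w <= avgs s (vari i F) w.
Proof.
elim: s w => //= j s IH w; rewrite inE negb_or => /andP[ij /IH{}IH].
by apply: le_trans (vari_avg _ _ ij) _; exact: avg_le.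
Qed.

(** The martingale decomposition of the variance: averaging one more coordinate
    adds the variance of the averaged function in that coordinate, which is at
    most the average of the variance by [vari_avgs]. *)
Lemma avgs_variance s F w : uniq s ->
  2 * (avgs s (fun w => F w ^+ 2) w - avgs s F w ^+ 2) <=
  \sum_(i <- s) avgs s (vari i F) w.
Proof.
elim: s w => [|i s IH] w /=; first by rewrite big_nil subrr mulr0.
move=> /andP[isN us].
have -> : 2 * (avg i (avgs s (fun w => F w ^+ 2)) w - avg i (avgs s F) w ^+ 2) =
  avg i (fun w => 2 * (avgs s (fun w => F w ^+ 2) w - avgs s F w ^+ 2)) w +
  vari i (avgs s F) w.
  rewrite variE.
  have -> : avg i (fun w => 2 * (avgs s (fun w => F w ^+ 2) w - avgs s F w ^+ 2)) w =
    2 * (avg i (avgs s (fun w => F w ^+ 2)) w - avg i (fun w => avgs s F w ^+ 2) w).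
    rewrite /avg -sumrB big_distrr; apply: eq_bigr => v _ /=; ring.
  by ring.
rewrite big_cons addrC lerD //.
  rewrite avgs_avg //; apply: le_trans (vari_avgs _ _ isN) _.
  have E w' : vari i F w' = avg i (vari i F) w'.
    rewrite /avg (eq_bigr (fun v => p i v * vari i F w')).
      by rewrite -big_distrl /= p_sum1 mul1r.
    move=> v _; congr (_ * _); apply: eq_bigr => z _; apply: eq_bigr => z' _.
    by rewrite !upd_upd.
  by rewrite [X in avgs s X](funext E).
have -> : \sum_(j <- s) avg i (avgs s (vari j F)) w =
    avg i (fun w => \sum_(j <- s) avgs s (vari j F) w) w.
  by rewrite /avg exchange_big; apply: eq_bigr => v _; rewrite big_distrr.
by apply: avg_le => w'; exact: IH.
Qed.

Lemma Ex_variance F :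
  2 * (Ex (fun w => F w ^+ 2) - Ex F ^+ 2) <= \sum_i Ex (vari i F).
Proof.
have [w _|w0] := pickP (@predT Omega).
  have := @avgs_variance (enum J) F w (enum_uniq _).
  by rewrite !avgs_enum big_enum; under eq_bigr do rewrite avgs_enum.
have E0 G : Ex G = 0 by rewrite /Ex big1 // => w; have := w0 w.
by rewrite !E0 expr0n subrr mulr0 big1.
Qed.

(** Efron-Stein inequality: by symmetry between the two copies of a resampled
    coordinate, only the increments in one direction have to be controlled. *)
Lemma efron_stein F (M : J -> Omega -> R) :
  (forall i w, 0 <= M i w) ->
  (forall i w v, F (upd w i v) - F w <= M i w) ->
  Ex (fun w => F w ^+ 2) - Ex F ^+ 2 <= Ex (fun w => \sum_i M i w ^+ 2).
Proof.
move=> M0 FM; rewrite -(ler_pM2l (ltr0n R 2)).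
apply: le_trans (Ex_variance F) _; rewrite Ex_sum big_distrr;
  apply: ler_sum => i _.
pose pos (x : R) := Num.max 0 x.
pose H w := \sum_v p i v * pos (F (upd w i v) - F w) ^+ 2.
have -> : Ex (vari i F) = 2 * Ex H.
  rewrite -(Ex_avg i) -(Ex_avg i H) -ExZ; congr Ex; apply/funext => w.
  have posE (x : R) : x ^+ 2 = pos x ^+ 2 + pos (- x) ^+ 2.
    rewrite /pos /Num.max oppr_gt0; case: ltgtP => [x0|x0|<-]; lra.
  have -> : avg i (vari i F) w = vari i F w.
    rewrite /avg.
    rewrite (eq_bigr (fun v => p i v * vari i F w)).
      by rewrite -big_distrl /= p_sum1 mul1r.
    move=> v _; congr (_ * _); apply: eq_bigr => z _; apply: eq_bigr => z' _.
    by rewrite !upd_upd.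
  rewrite /vari.
  pose h v v' := p i v * p i v' * pos (F (upd w i v') - F (upd w i v)) ^+ 2.
  transitivity (\sum_v \sum_v' (h v v' + h v' v)).
    apply: eq_bigr => v _; apply: eq_bigr => v' _;
      rewrite /h [LHS]mulrC posE opprB.
    ring.
  transitivity (\sum_v (\sum_v' h v v' + \sum_v' h v' v)).
    by apply: eq_bigr => v _; rewrite big_split.
  rewrite big_split /= [X in _ + X]exchange_big -mulr2n -[LHS]mulr_natl.
  congr (_ * _); rewrite /avg; apply: eq_bigr => v _; rewrite /H big_distrr;
    apply: eq_bigr => v' _ /=.
  by rewrite upd_upd /h mulrA.
rewrite /= ler_pM2l //; apply: Ex_le => w.
rewrite -[leRHS]mul1r -(p_sum1 i) big_distrl; apply: ler_sum => v _ /=.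
rewrite ler_wpM2l // lerXn2r ?nnegrE // /pos; first by rewrite le_max lexx.
by rewrite ge_max M0 FM.
Qed.

End FiniteProduct.

(** * Exponential moments *)

Section ExponentialMoments.
Context (R : realType).
Implicit Types x : R.

Lemma expR_le_inv x : x < 1 -> expR x <= (1 - x)^-1.
Proof.
move=> x1; rewrite -[expR x]invrK -expRN lef_pV2 ?posrE ?subr_gt0 ?expR_gt0 //.
by have := expR_ge1Dx (- x).
Qed.

Lemma expR_le_quadratic x : x <= 2^-1 -> expR x <= 1 + x + 2 * x ^+ 2.
Proof.
move=> x2; apply: le_trans (expR_le_inv _) _; first lra.
rewrite -[_^-1]mul1r ler_pdivrMr; last lra.
have -> : (1 + x + 2 * x ^+ 2) * (1 - x) = 1 + x ^+ 2 * (1 - 2 * x) by ring.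
by rewrite lerDl mulr_ge0 ?sqr_ge0 //; lra.
Qed.

Lemma expR_le_linear x : 0 <= x <= 2^-1 -> expR x <= 1 + 2 * x.
Proof.
move=> /andP[x0 x2]; apply: le_trans (expR_le_quadratic x2) _; nra.
Qed.

Context (J V : finType) (p : J -> V -> R).
Hypothesis p_ge0 : forall i v, 0 <= p i v.
Hypothesis p_sum1 : forall i, \sum_v p i v = 1.
Local Notation Omega := {ffun J -> V}.
Local Notation E := (Ex p).
Context (Z : Omega -> R) (L : J -> Omega -> R) (sigma : R).
Hypothesis sigma_gt0 : 0 < sigma.
Hypothesis L_ge0 : forall i w, 0 <= L i w.
Hypothesis ZL : forall i w v, Z (upd w i v) - Z w <= L i w.
Hypothesis Lsigma : forall w, \sum_i L i w ^+ 2 <= sigma ^+ 2.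

Let mgf (s : R) := E (fun w => expR (s * (Z w - E Z))).

Lemma increment_le_sigma i w : L i w <= sigma.
Proof.
rewrite -(@ler_pXn2r _ 2%N) ?nnegrE // ?(ltW sigma_gt0) //.
apply: le_trans (Lsigma w); rewrite (bigD1 i) //= lerDl.
by apply: sumr_ge0 => j _; exact: sqr_ge0.
Qed.

Lemma Ex_variance_le : E (fun w => (Z w - E Z) ^+ 2) <= sigma ^+ 2.
Proof.
have -> : E (fun w => (Z w - E Z) ^+ 2) = E (fun w => Z w ^+ 2) - E Z ^+ 2.
  set m := E Z.
  transitivity (E (fun w => Z w ^+ 2 + ((- 2 * m) * Z w + m ^+ 2))).
    by congr Ex; apply/funext => w; ring.
  by rewrite !ExD ExZ -/m Ex_cst //; ring.
apply: le_trans (efron_stein p_ge0 p_sum1 L_ge0 ZL) _.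
rewrite -(Ex_cst p_sum1 (sigma ^+ 2)); exact: Ex_le.
Qed.

(** Efron-Stein for [exp (s Z)]. For [s < 0] it is applied to [- exp (s Z)], so
    that in both cases only upward increments of [Z] enter. *)
Lemma mgf_efron_stein s : `|s| * sigma <= 2^-1 ->
  mgf (2 * s) - mgf s ^+ 2 <= 4 * s ^+ 2 * sigma ^+ 2 * mgf (2 * s).
Proof.
move=> ssig; set m := E Z.
pose e w := expR (s * (Z w - m)).
have H2 : mgf (2 * s) = E (fun w => e w ^+ 2).
  by congr Ex; apply/funext => w; rewrite /e -mulrA expRM_natl.
pose M i w := 2 * `|s| * L i w * e w.
have M0 i w : 0 <= M i w by rewrite /M !mulr_ge0 ?expR_ge0.
have eupd w i v : e (upd w i v) = e w * expR (s * (Z (upd w i v) - Z w)).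
  by rewrite /e -expRD; congr expR; ring.
have sL i w : 0 <= `|s| * L i w <= 2^-1.
  rewrite mulr_ge0 //=; apply: le_trans ssig.
  by rewrite ler_wpM2l // increment_le_sigma.
have ML : E (fun w => \sum_i M i w ^+ 2) <= 4 * s ^+ 2 * sigma ^+ 2 * mgf (2 * s).
  rewrite H2 -ExZ; apply: Ex_le => // w.
  have -> : \sum_i M i w ^+ 2 = 4 * s ^+ 2 * e w ^+ 2 * \sum_i L i w ^+ 2.
    rewrite big_distrr; apply: eq_bigr => i _ /=.
    by rewrite /M !exprMn real_normK ?num_real //; ring.
  rewrite [leRHS](_ : _ = 4 * s ^+ 2 * e w ^+ 2 * sigma ^+ 2); last by ring.
  by rewrite ler_wpM2l // (mulr_ge0 (mulr_ge0 _ (sqr_ge0 s)) (sqr_ge0 _)).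
apply: le_trans ML; rewrite H2; have [s0|s0] := leP 0 s.
  apply: (efron_stein p_ge0 p_sum1 M0) => i w v.
  rewrite eupd /M mulrC -[X in _ - X]mul1r -mulrBl ler_wpM2r ?expR_ge0 //.
  rewrite lerBlDl -mulrA; apply: le_trans (expR_le_linear (sL i w)).
  by rewrite ler_expR ger0_norm // ler_wpM2l.
have -> : E (fun w => e w ^+ 2) - mgf s ^+ 2 =
    E (fun w => (- e w) ^+ 2) - E (fun w => - e w) ^+ 2.
  congr (E _ - _); first by apply/funext => w; rewrite sqrrN.
  have -> : E (fun w => - e w) = - 1 * E e.
    by rewrite -ExZ; congr Ex; apply/funext => w; rewrite mulN1r.
  by rewrite mulN1r sqrrN.
apply: (efron_stein p_ge0 p_sum1 M0) => i w v.
rewrite eupd /M opprK addrC -[X in X - _]mulr1 -mulrBr mulrC ler_wpM2r ?expR_ge0 //.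
rewrite lerBlDl -lerBlDr.
apply: le_trans (_ : 1 + s * L i w <= _).
  have := sL i w; rewrite ltr0_norm // => /andP[]; lra.
apply: le_trans (expR_ge1Dx _) _; rewrite ler_expR.
by rewrite ler_wnM2l // ltW.
Qed.

Lemma mgf_ge0 s : 0 <= mgf s.
Proof. by apply: sumr_ge0 => w _; rewrite mulr_ge0 ?expR_ge0 // mass_ge0. Qed.

(** The previous inequality solved for [mgf (2 * s)]: with [x = s^2 sigma^2], one
    has [1 <= exp (8 x) (1 - 4 x)] as long as [x <= 1 / 16]. *)
Lemma mgf_doubling s : `|s| * sigma <= 4^-1 ->
  mgf (2 * s) <= expR (8 * s ^+ 2 * sigma ^+ 2) * mgf s ^+ 2.
Proof.
move=> ssig; have ss0 : 0 <= `|s| * sigma by rewrite mulr_ge0 // ltW.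
have := mgf_efron_stein; move=> /(_ s); rewrite (le_trans ssig) //; last by lra.
move=> /(_ isT) HH.
pose x := s ^+ 2 * sigma ^+ 2.
have x16 : x <= 16^-1.
  have -> : x = (`|s| * sigma) ^+ 2 by rewrite exprMn real_normK ?num_real.
  apply: le_trans (_ : 4^-1 ^+ 2 <= _); last by lra.
  by rewrite lerXn2r ?nnegrE //; lra.
have x0 : 0 <= x by rewrite mulr_ge0 ?sqr_ge0.
have {}HH : mgf (2 * s) * (1 - 4 * x) <= mgf s ^+ 2.
  by rewrite /x; move: HH; lra.
have e8 : 1 <= expR (8 * x) * (1 - 4 * x).
  apply: le_trans (_ : (1 + 8 * x) * (1 - 4 * x) <= _); first by nra.
  by rewrite ler_wpM2r ?expR_ge1Dx //; lra.
rewrite -mulrA -/x;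
  apply: le_trans (_ : expR (8 * x) * (mgf (2 * s) * (1 - 4 * x)) <= _).
  by rewrite mulrCA -[leLHS]mulr1 ler_wpM2l // mgf_ge0.
by rewrite ler_wpM2l ?expR_ge0.
Qed.

(** For tiny [s] the centring of [Z] makes [mgf s] quadratically close to [1]. *)
Lemma mgf_small (b s : R) : (forall w, `|Z w - E Z| <= b) -> `|s| * b <= 2^-1 ->
  mgf s <= expR (2 * s ^+ 2 * b ^+ 2).
Proof.
move=> Zb sb; apply: le_trans (expR_ge1Dx _); set m := E Z.
have -> : 1 + 2 * s ^+ 2 * b ^+ 2 =
    E (fun w => 1 + s * (Z w - m) + 2 * s ^+ 2 * b ^+ 2).
  transitivity (E (fun w => s * Z w + (1 - s * m + 2 * s ^+ 2 * b ^+ 2))).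
    by rewrite ExD ExZ Ex_cst // -/m; ring.
  by congr Ex; apply/funext => w; ring.
apply: Ex_le => // w; have := Zb w; rewrite -/m => Zbw.
have le1 : `|s * (Z w - m)| <= 2^-1.
  by rewrite normrM; apply: le_trans sb; rewrite ler_wpM2l.
apply: le_trans (expR_le_quadratic _) _.
  by apply: le_trans le1; exact: ler_norm.
rewrite lerD2l exprMn -mulrA ler_pM2l // ler_wpM2l ?sqr_ge0 //.
by rewrite -real_normK ?num_real // lerXn2r ?nnegrE // (le_trans _ Zbw).
Qed.

(** The exponent [4 s^2 sigma^2] reproduces itself under doubling, since
    [2 * 4 + 8 = 4 * 2^2], while the error term inherited from the base scale
    only doubles. *)
Lemma mgf_iter (b s : R) n : (forall w, `|Z w - E Z| <= b) -> `|s| * b <= 2^-1 ->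
  `|2 ^+ n * s| * sigma <= 2^-1 ->
  mgf (2 ^+ n * s) <=
    expR (4 * (2 ^+ n * s) ^+ 2 * sigma ^+ 2 + 2 ^+ n * (2 * s ^+ 2 * b ^+ 2)).
Proof.
move=> Zb sb; elim: n => [|n IH] ssig.
  rewrite expr0 !mul1r; apply: le_trans (mgf_small Zb sb) _.
  by rewrite ler_expR lerDr (mulr_ge0 (mulr_ge0 _ (sqr_ge0 s)) (sqr_ge0 _)).
have half : `|2 ^+ n * s| * sigma <= 4^-1.
  by move: ssig; rewrite exprS -[2 * _ * s]mulrA (normrM 2) ger0_norm //; lra.
rewrite exprS -[2 * _ * s]mulrA; set t := 2 ^+ n * s in half IH *.
apply: le_trans (mgf_doubling half) _.
have {}IH := IH (le_trans half _).
set x := expR (4 * t ^+ 2 * sigma ^+ 2 + _) in IH.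
apply: le_trans (_ : expR (8 * t ^+ 2 * sigma ^+ 2) * x ^+ 2 <= _).
  rewrite ler_wpM2l ?expR_ge0 // lerXn2r ?nnegrE ?mgf_ge0 ?expR_ge0 //.
  by apply: IH; lra.
by rewrite /x -expRM_natl -expRD ler_expR; lra.
Qed.

(** Iterating the doubling bound from an arbitrarily small scale leaves no
    trace of the crude bound on [Z] at the base of the induction. *)
Lemma mgf_le s (eps : R) : 0 < eps -> `|s| * sigma <= 2^-1 ->
  mgf s <= expR (4 * s ^+ 2 * sigma ^+ 2 + eps).
Proof.
move=> eps0 ssig.
pose b := \sum_w `|Z w - E Z| + 1.
have Zb w : `|Z w - E Z| <= b.
  rewrite /b (bigD1 w) //= -addrA lerDl addr_ge0 // sumr_ge0 //.
have b1 : 1 <= b by rewrite /b lerDr sumr_ge0.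
(* The first summand makes the scale [s / 2 ^ n] admissible for [mgf_small], the
   second one makes the inherited error at most [eps]. *)
pose K := 2 * `|s| * b + 2 * s ^+ 2 * b ^+ 2 / eps.
have [n Kn] : exists n, K <= 2 ^+ n.
  exists (Num.bound `|K|); apply: le_trans (ler_norm _) _; apply: ltW.
  apply: lt_le_trans (archi_boundP (normr_ge0 K)) _.
  by rewrite -natrX ler_nat ltnW // ltn_expl.
have p2 : 0 < 2 ^+ n :> R by rewrite exprn_gt0.
have K1 : 2 * `|s| * b <= K by rewrite lerDl divr_ge0 ?(ltW eps0) // (mulr_ge0 (mulr_ge0 _ (sqr_ge0 s)) (sqr_ge0 _)).
have K2 : 2 * s ^+ 2 * b ^+ 2 / eps <= K.
  by rewrite lerDr !mulr_ge0 // (le_trans _ b1).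
have sE : s = 2 ^+ n * (s / 2 ^+ n) by rewrite mulrC divfK // gt_eqF.
rewrite {1}sE; apply: le_trans (@mgf_iter b (s / 2 ^+ n) n Zb _ _) _.
- rewrite normrM normfV (ger0_norm (ltW p2)) mulrAC ler_pdivrMr //.
  by have := le_trans K1 Kn; lra.
- by rewrite -sE.
rewrite -sE ler_expR lerD2l.
have := le_trans K2 Kn; rewrite ler_pdivrMr // => K2n.
rewrite exprMn exprVn.
have -> : 2 ^+ n * (2 * (s ^+ 2 / (2 ^+ n) ^+ 2) * b ^+ 2) =
   (2 * s ^+ 2 * b ^+ 2) / 2 ^+ n by field; rewrite gt_eqF.
by rewrite ler_pdivrMr // [leRHS]mulrC.
Qed.

(** Markov's inequality for both signs of [s], at [s = 1 / (4 sigma)]. *)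
Lemma Ex_tail (tau : R) :
  E (fun w => (tau <= `|Z w - E Z|)%R%:R) <= 3 * expR (- (tau / (4 * sigma))).
Proof.
pose s := (4 * sigma)^-1.
have s0 : 0 < s by rewrite invr_gt0 mulr_gt0.
have ssig : s * sigma = 4^-1 by rewrite /s invfM mulfVK // gt_eqF.
have h (r : R) : `|r| = s -> mgf r <= 3 / 2.
  move=> rs; apply: le_trans (@mgf_le r 12^-1 _ _) _ => //.
    by rewrite rs ssig; lra.
  (* [1 / 12] brings the exponent to [1 / 3], where [exp (1 / 3) <= 3 / 2]. *)
  have -> : 4 * r ^+ 2 * sigma ^+ 2 + 12^-1 = 3^-1 :> R.
    rewrite -(real_normK (num_real r)) rs -mulrA -exprMn ssig; lra.
  apply: le_trans (expR_le_inv _) _; first lra.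
  by rewrite (_ : (1 - 3^-1)^-1 = 3 / 2 :> R) //; field.
apply: le_trans (_ : expR (- (tau * s)) * (mgf s + mgf (- s)) <= _); last first.
  rewrite mulrC ler_wpM2r ?expR_ge0 //.
  have := h s; have := h (- s);
    rewrite normrN gtr0_norm // => /(_ erefl) ? /(_ erefl) ?.
  lra.
rewrite -ExD -ExZ; apply: Ex_le => // w; set z := Z w - E Z.
have e0 := expR_ge0; case: (leP tau `|z|) => tz;
  last by rewrite mulr_ge0 ?addr_ge0.
rewrite mulrDr -!expRD; case: (leP 0 z) => z0.
  apply: le_trans (_ : expR (- (tau * s) + s * z) <= _); last by rewrite lerDl.
  rewrite -expR0 ler_expR; move: tz; rewrite ger0_norm // => tz; nra.
apply: le_trans (_ : expR (- (tau * s) + - s * z) <= _); last by rewrite lerDr.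
rewrite -expR0 ler_expR; move: tz; rewrite ltr0_norm // => tz; nra.
Qed.

End ExponentialMoments.

(** * The Dirichlet form on the box *)

Section Box.
Context (R : realType) (d N : nat).
Local Notation box := (box d N).
Local Notation D := (@dirichlet_space d R N).
Implicit Types (x y : box) (c : environment d R) (u v phi : box -> R).

Definition adj x y : bool :=
  nn (box_site x) (box_site y) && (interior_box x || interior_box y).

Definition bedge x y : {fset site d} := edge (box_site x) (box_site y).

Lemma nnC (x y : site d) : nn x y = nn y x.
Proof.
by rewrite /nn; congr (_ == _); apply: eq_bigr => i _; rewrite -sqrrN opprB.
Qed.

Lemma adjC x y : adj x y = adj y x.
Proof. by rewrite /adj nnC orbC. Qed.

Lemma adj_lattice x y : adj x y -> lattice_edges (bedge x y).
Proof. by move=> /andP[xy _]; exists (box_site x), (box_site y). Qed.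

Lemma box_site_inj : injective (@box_site d N).
Proof.
move=> x y /ffunP xy; apply/ffunP => i; apply/val_inj.
by have := xy i; rewrite !ffunE => -[].
Qed.

(** Distinct sites of the box are distinct lattice sites, so an edge determines
    its ordered pair of endpoints up to exchange. *)
Lemma bedge_inj x y x' y' : bedge x y = bedge x' y' ->
  (x' = x /\ y' = y) \/ (x' = y /\ y' = x).
Proof.
move=> /fsetP E;
  have inE' z : (box_site z \in bedge x y) = (z == x) || (z == y).
  by rewrite !inE !(inj_eq box_site_inj).
have := E (box_site x); have := E (box_site y); have := E (box_site x').
have := E (box_site y'); rewrite !inE !(inj_eq box_site_inj) !eqxx /= ?orbT.
move=> /orP[/eqP->|/eqP->] /orP[/eqP->|/eqP->]; rewrite ?eqxx ?orbb.
- by move=> /esym/eqP-> _; left.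
- by right.
- by left.
- by move=> _ /esym/eqP->; left.
Qed.

(** Every lattice neighbour of an interior site lies in the box. *)
Lemma site_weightE c x : interior_box x ->
  site_weight c (box_site x) = \sum_(y | adj x y) c (bedge x y).
Proof.
move=> intx; rewrite /site_weight.
have -> : [set y | nn (box_site x) y] =
    [set` [seq box_site y | y <- enum (adj x)]].
  apply/seteqP; split => y /=; last first.
    by move=> /mapP[z]; rewrite mem_enum => /andP[] ? _ ->.
  move=> /eqP xy.
  have y_close i : `|(x i : nat)%:Z - y i| <= 1.
    rewrite -(@ler_pXn2r _ 2%N) ?nnegrE // expr1n real_normK ?num_real // -xy.
    rewrite (bigD1 i) //= ffunE lerDl sumr_ge0 // => j _; exact: sqr_ge0.
  have yb i : (0 <= y i) && (y i < N.+2%:Z).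
    have /forallP/(_ i) := intx; have := y_close i; lia.
  pose z : box := [ffun i => inord (absz (y i))].
  have zy : box_site z = y.
    apply/ffunP => i; rewrite !ffunE; have /andP[y0 yN] := yb i.
    by rewrite inordK ?gez0_abs // -ltz_nat gez0_abs.
  apply/mapP; exists z; rewrite ?zy // mem_enum /in_mem /= /adj intx zy andbT.
  exact/eqP.
rewrite -fsbig_seq; last by rewrite (map_inj_uniq box_site_inj) enum_uniq.
by rewrite big_map big_enum.
Qed.

(** At most [3 ^ d] neighbours, since each coordinate moves by at most one. *)
Lemma card_adj x : (#|adj x| <= 3 ^ d)%N.
Proof.
have close y i : adj x y -> ((y i : nat) <= (x i).+1 <= (y i).+2)%N.
  move=> /andP[/eqP xy _];
    suff : `|(x i : nat)%:Z - (y i : nat)%:Z| <= 1 by lia.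
  rewrite -(@ler_pXn2r _ 2%N) ?nnegrE // expr1n real_normK ?num_real // -xy.
  rewrite (bigD1 i) //= !ffunE lerDl sumr_ge0 // => j _; exact: sqr_ge0.
pose f y : {ffun 'I_d -> 'I_3} := [ffun i => inord ((x i).+1 - y i)].
have finj : {in adj x &, injective f}.
  move=> y z; rewrite -!topredE /= => xy xz /ffunP fyz.
  apply/ffunP => i; apply/val_inj/eqP.
  have := congr1 val (fyz i); rewrite !ffunE /=.
  have /= := close y i xy; have /= := close z i xz.
  move=> ? ?; rewrite !inordK; lia.
by rewrite -(card_in_image finj) (leq_trans (max_card _)) // card_ffun !card_ord.
Qed.

(** Restricted to the edges of the box, so that the condition involves finitely
    many random variables. *)
Definition elliptic (kappa : R) c :=
  forall x y, adj x y -> kappa^-1 <= c (bedge x y) <= kappa.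

(** The inner product whose quadratic form is [norm2_sq]. *)
Definition weighted_ip c u v : R :=
  \sum_(x | interior_box x) u x * v x * site_weight c (box_site x).

Lemma norm2_sqE c u : norm2_sq c u =
  \sum_(x | interior_box x) \sum_(y | adj x y) c (bedge x y) * u x ^+ 2.
Proof.
apply: eq_bigr => x ix; rewrite site_weightE // mulrC big_distrl.
by apply: eq_bigr.
Qed.

Lemma dirichlet_formDZ c u phi (t : R) :
  dirichlet_form c (fun x => u x + t * phi x) (fun x => u x + t * phi x) =
  dirichlet_form c u u + 2 * t * dirichlet_form c u phi
    + t ^+ 2 * dirichlet_form c phi phi.
Proof.
rewrite /dirichlet_form [2 * t * _]mulrCA [t ^+ 2 * _]mulrCA -!mulrDr.
congr (_ * _); rewrite !big_distrr -!big_split; apply: eq_bigr => x _ /=.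
rewrite !big_distrr -!big_split; apply: eq_bigr => y _ /=; ring.
Qed.

Lemma norm2_sqDZ c u phi (t : R) :
  norm2_sq c (fun x => u x + t * phi x) =
  norm2_sq c u + 2 * t * weighted_ip c u phi + t ^+ 2 * norm2_sq c phi.
Proof.
rewrite !big_distrr -!big_split; apply: eq_bigr => x _ /=; ring.
Qed.

Lemma dirichlet_formZ c u (k : R) :
  dirichlet_form c (fun x => k * u x) (fun x => k * u x) =
  k ^+ 2 * dirichlet_form c u u.
Proof.
rewrite /dirichlet_form mulrCA; congr (_ * _); rewrite big_distrr;
  apply: eq_bigr => x _ /=.
rewrite big_distrr; apply: eq_bigr => y _ /=; ring.
Qed.

Lemma norm2_sqZ c u (k : R) :
  norm2_sq c (fun x => k * u x) = k ^+ 2 * norm2_sq c u.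
Proof. by rewrite big_distrr; apply: eq_bigr => x _ /=; ring. Qed.

Section Elliptic.
Context (kappa : R) (c : environment d R).
Hypothesis kappa_ge1 : 1 <= kappa.
Hypothesis c_ell : elliptic kappa c.
Local Notation lam := (principal_eigenvalue N c).

Let kappa_gt0 : 0 < kappa. Proof. exact: lt_le_trans kappa_ge1. Qed.

Lemma conductance_gt0 x y : adj x y -> 0 < c (bedge x y).
Proof.
move=> /c_ell/andP[+ _]; apply: lt_le_trans.
by rewrite invr_gt0.
Qed.

Lemma dirichlet_form_ge0 u : 0 <= dirichlet_form c u u.
Proof.
apply: mulr_ge0 => //; apply: sumr_ge0 => x _; apply: sumr_ge0 => y xy.
by rewrite -mulrA mulr_ge0 -?expr2 ?sqr_ge0 // ltW // conductance_gt0.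
Qed.

Lemma norm2_sq_ge0 u : 0 <= norm2_sq c u.
Proof.
rewrite norm2_sqE; apply: sumr_ge0 => x _; apply: sumr_ge0 => y xy.
by rewrite mulr_ge0 ?sqr_ge0 // ltW // conductance_gt0.
Qed.

Lemma rayleigh_has_lbound :
  has_lbound [set dirichlet_form c u u | u in
    [set u : box -> R | D u /\ norm2_sq c u = 1]].
Proof. by exists 0 => _ [u _ <-]; exact: dirichlet_form_ge0. Qed.

Lemma principal_eigenvalue_ge0 : 0 <= lam.
Proof.
have [[r Ar]|] := pselect ([set dirichlet_form c u u | u in
    [set u : box -> R | D u /\ norm2_sq c u = 1]] !=set0).
  apply: lb_le_inf; first by exists r.
  by move=> _ [u _ <-]; exact: dirichlet_form_ge0.
move=> /set0P/negP; rewrite negbK => /eqP E.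
by rewrite /principal_eigenvalue E inf0.
Qed.

Lemma rayleigh u : D u -> lam * norm2_sq c u <= dirichlet_form c u u.
Proof.
move=> Du; have := norm2_sq_ge0 u; rewrite le_eqVlt => /orP[/eqP<-|m0].
  by rewrite mulr0 dirichlet_form_ge0.
rewrite -ler_pdivlMr //; apply: ge_inf; first exact: rayleigh_has_lbound.
pose k := (Num.sqrt (norm2_sq c u))^-1.
have k2 : k ^+ 2 = (norm2_sq c u)^-1 by rewrite exprVn sqr_sqrtr // ltW.
exists (fun x => k * u x); last by rewrite dirichlet_formZ k2 mulrC.
split; first by move=> x ix; rewrite Du // mulr0.
by rewrite norm2_sqZ k2 mulVf // gt_eqF.
Qed.

End Elliptic.
End Box.

(** * Existence of a non-negative ground state *)

Section Limits.
Context (R : realType) (T : Type) (F : set_system T) (FF : Filter F).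

Lemma cvg_bigsum (I : Type) (r : seq I) (P : pred I) (f : I -> T -> R) (l : I -> R) :
  (forall i, P i -> f i t @[t --> F] --> l i) ->
  \sum_(i <- r | P i) f i t @[t --> F] --> \sum_(i <- r | P i) l i.
Proof.
move=> fl; elim: r => [|i r IH].
  by under eq_fun do rewrite big_nil; rewrite big_nil; exact: cvg_cst.
under eq_fun do rewrite big_cons; rewrite big_cons.
case: ifPn => Pi; last exact: IH.
by apply: cvgD; [exact: fl | exact: IH].
Qed.

Context (d N : nat) (c : environment d R) (v : T -> box d N -> R) (u : box d N -> R).
Hypothesis vu : forall x, v t x @[t --> F] --> u x.

Lemma cvg_dirichlet_form :
  dirichlet_form c (v t) (v t) @[t --> F] --> dirichlet_form c u u.
Proof.
rewrite /dirichlet_form; apply: cvgM; first exact: cvg_cst.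
apply: cvg_bigsum => x _; apply: cvg_bigsum => y _.
have vB : v t x - v t y @[t --> F] --> u x - u y by apply: cvgB; exact: vu.
by apply: cvgM => //; apply: cvgM => //; exact: cvg_cst.
Qed.

Lemma cvg_norm2_sq : norm2_sq c (v t) @[t --> F] --> norm2_sq c u.
Proof.
rewrite /norm2_sq; apply: cvg_bigsum => x _.
by apply: cvgM; [apply: cvgM; exact: vu | exact: cvg_cst].
Qed.

End Limits.

Section GroundState.
Context (R : realType) (d N : nat) (kappa : R) (c : environment d R).
Hypothesis kappa_ge1 : 1 <= kappa.
Hypothesis c_ell : elliptic N kappa c.
Hypothesis d_gt0 : (0 < d)%N.
Local Notation box := (box d N).
Local Notation D := (@dirichlet_space d R N).
Local Notation lam := (principal_eigenvalue N c).
Implicit Types (x y : box) (u v phi : box -> R).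

Let kappa_gt0 : 0 < kappa. Proof. exact: lt_le_trans kappa_ge1. Qed.

Lemma site_weight_ge x : interior_box x -> kappa^-1 <= site_weight c (box_site x).
Proof.
move=> ix; rewrite site_weightE //.
pose i0 := Ordinal d_gt0.
have /forallP xN := ix.
pose y : box := [ffun i => if i == i0 then inord (x i).+1 else x i].
have xy : adj x y.
  rewrite /adj ix andbT /nn (bigD1 i0) //= big1 => [|i /negbTE ii0].
    rewrite !ffunE eqxx inordK; first by rewrite addr0 -sqrrN opprB; lia.
    by have := xN i0; lia.
  by rewrite !ffunE ii0 subrr.
have /andP[cl _] := c_ell xy.
apply: le_trans cl _; rewrite (bigD1 y) //= lerDl.
by apply: sumr_ge0 => z /andP[xz _];
  rewrite ltW // (conductance_gt0 kappa_ge1 c_ell).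
Qed.

Lemma site_weight_le x : interior_box x ->
  site_weight c (box_site x) <= 3 ^+ d * kappa.
Proof.
move=> ix; rewrite site_weightE //.
apply: le_trans (_ : \sum_(y | adj x y) kappa <= _).
  by apply: ler_sum => y /c_ell/andP[].
rewrite sumr_const -[leLHS]mulr_natl ler_wpM2r ?(ltW kappa_gt0) //.
by rewrite -natrX ler_nat card_adj.
Qed.

Lemma norm2_sq_ge_sum u : D u -> kappa^-1 * \sum_x u x ^+ 2 <= norm2_sq c u.
Proof.
move=> Du; rewrite (bigID (@interior_box d N)) /= [X in _ + X]big1 => [|x /Du->].
  rewrite addr0 big_distrr; apply: ler_sum => x ix /=.
  by rewrite mulrC ler_wpM2l ?sqr_ge0 // site_weight_ge.
by rewrite expr0n.
Qed.

Lemma sum_sq_ge u x : u x ^+ 2 <= \sum_y u y ^+ 2.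
Proof.
by rewrite (bigD1 x) //= lerDl; apply: sumr_ge0 => y _; exact: sqr_ge0.
Qed.

Hypothesis N_gt0 : (0 < N)%N.

Lemma normalized_nonempty :
  [set u : box -> R | D u /\ norm2_sq c u = 1] !=set0.
Proof.
pose x0 : box := [ffun=> inord 1].
have ix0 : interior_box x0 by apply/forallP => i; rewrite ffunE inordK; lia.
pose u x : R := (x == x0)%:R.
have Du : D u by move=> x; rewrite /u; case: eqP => // ->; rewrite ix0.
have m0 : 0 < norm2_sq c u.
  apply: lt_le_trans (norm2_sq_ge_sum Du); rewrite mulr_gt0 ?invr_gt0 //.
  by apply: lt_le_trans (sum_sq_ge u x0); rewrite /u eqxx expr1n.
exists (fun x => (Num.sqrt (norm2_sq c u))^-1 * u x); split.
  by move=> x /Du->; rewrite mulr0.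
by rewrite norm2_sqZ exprVn sqr_sqrtr ?ltW // mulVf // gt_eqF.
Qed.

Lemma abs_dirichlet_form_le u :
  dirichlet_form c (fun x => `|u x|) (fun x => `|u x|) <= dirichlet_form c u u.
Proof.
rewrite ler_wpM2l ?invr_ge0 //; apply: ler_sum => x _; apply: ler_sum => y xy.
rewrite -!mulrA ler_wpM2l ?(ltW (conductance_gt0 kappa_ge1 c_ell xy)) // -!expr2.
rewrite -[leRHS]real_normK ?num_real // -[leLHS]real_normK ?num_real //.
by rewrite lerXn2r ?nnegrE // ler_dist_dist.
Qed.

(** Ellipticity makes the normalised test functions a compact set. Passing to
    [`|u|] does not increase the energy, so the minimiser can be taken
    non-negative, as the inequality [expr_diff_le] between its powers demands. *)
Lemma exists_minimizer : exists u : box -> R,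
  [/\ D u, forall x, 0 <= u x, norm2_sq c u = 1 & dirichlet_form c u u = lam].
Proof.
pose T := prod_topology (fun _ : box => R).
pose A := [set u : T | D u /\ norm2_sq c u = 1].
have cproj x : continuous (fun u : T => u x : R).
  exact: (@proj_continuous box (fun _ => R) x).
have cE : continuous (fun u : T => dirichlet_form c u u).
  by move=> u;
    exact: (@cvg_dirichlet_form R T (nbhs u) (nbhs_filter u) d N c (fun v : T => v) u
    (fun x => cproj x u)).
have cm : continuous (fun u : T => norm2_sq c u).
  by move=> u;
    exact: (@cvg_norm2_sq R T (nbhs u) (nbhs_filter u) d N c (fun v : T => v) u
    (fun x => cproj x u)).
have clA : closed A.
  have -> : A = (fun u : T => \sum_(x | ~~ interior_box x) u x ^+ 2
      + (norm2_sq c u - 1) ^+ 2) @^-1` [set 0].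
    apply/seteqP; split => u /=.
      by move=> [Du ->]; rewrite subrr expr0n addr0 big1 // => x /Du->;
        rewrite expr0n.
    have s0 : 0 <= \sum_(x | ~~ interior_box x) u x ^+ 2.
      by apply: sumr_ge0 => x _; exact: sqr_ge0.
    move=> /eqP; rewrite paddr_eq0 ?sqr_ge0 // => /andP[/eqP u0].
    rewrite sqrf_eq0 subr_eq0 => /eqP; split=> // x ix; apply/eqP.
    rewrite -sqrf_eq0; apply/eqP.
    by apply: (psumr_eq0P _ u0) => // y _; exact: sqr_ge0.
  apply: preimage_closed; last exact: closed_eq.
  move=> u _.
  have c1 : \sum_(x | ~~ interior_box x) v x ^+ 2 @[v --> u] -->
      \sum_(x | ~~ interior_box x) u x ^+ 2.
    apply: (@cvg_bigsum R T (nbhs u) (nbhs_filter u)) => x _.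
    by have cx := cproj x u; exact: (cvgM cx cx).
  have c2 : norm2_sq c v - 1 @[v --> u] --> norm2_sq c u - 1.
    by have cu := cm u; exact: (cvgB cu (cvg_cst _)).
  exact: (cvgD c1 (cvgM c2 c2)).
have cA : compact A.
  apply: (subclosed_compact clA
    (@tychonoff box (fun _ => R) (fun _ => `[- kappa, kappa]%classic) _)).
    by move=> _; exact: segment_compact.
  move=> u [Du u1] x /=; rewrite in_itv /= -ler_norml.
  rewrite -(@ler_pXn2r _ 2%N) ?nnegrE ?(ltW kappa_gt0) // real_normK ?num_real //.
  have := norm2_sq_ge_sum Du; rewrite u1 mulrC ler_pdivrMr // mul1r.
  move=> /(le_trans (sum_sq_ge u x))/le_trans; apply.
  by rewrite expr2 ler_peMl // ltW.
have A0 : A !=set0 by exact: normalized_nonempty.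
have [u /set_mem[Du u1] umin] := compact_EVT_min A0 cA (continuous_subspaceT cE).
exists (fun x => `|u x|).
have Dv : D (fun x => `|u x|) by move=> x /Du->; rewrite normr0.
have v1 : norm2_sq c (fun x => `|u x|) = 1.
  by rewrite -u1; apply: eq_bigr => x _; rewrite real_normK ?num_real.
split => //; apply/eqP; rewrite eq_le; apply/andP; split.
  apply: le_trans (abs_dirichlet_form_le u) _.
  apply: lb_le_inf; first by exists (dirichlet_form c u u), u.
  by move=> _ [v Av <-]; apply: umin; exact/mem_set.
by have := rayleigh kappa_ge1 c_ell Dv; rewrite v1 mulr1.
Qed.

(** The quadratic polynomial [t |-> E(u + t phi) - lam |u + t phi|^2] is
    non-negative and vanishes at [0], so its linear coefficient is zero. *)
Lemma euler_lagrange u phi : D u -> norm2_sq c u = 1 ->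
  dirichlet_form c u u = lam -> D phi ->
  dirichlet_form c u phi = lam * weighted_ip c u phi.
Proof.
move=> Du u1 ulam Dphi; apply/eqP; rewrite -subr_eq0; apply/eqP.
set b := (X in X = 0).
set q := dirichlet_form c phi phi - lam * norm2_sq c phi.
have quad t : 0 <= 2 * t * b + t ^+ 2 * q.
  have Dt : D (fun x => u x + t * phi x).
    by move=> x ix; rewrite Du // Dphi // mulr0 addr0.
  have := rayleigh kappa_ge1 c_ell Dt.
  rewrite dirichlet_formDZ norm2_sqDZ u1 ulam -subr_ge0.
  by congr (_ <= _); rewrite /b /q; ring.
have q0 : 0 <= q by have := quad 1; have := quad (-1); lra.
have q1 : 0 < q + 1 by lra.
(* [q + 1] instead of [q] avoids dividing by zero and still gives the sign. *)
have := quad (- b / (q + 1)).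
have -> : 2 * (- b / (q + 1)) * b + (- b / (q + 1)) ^+ 2 * q =
   - (b ^+ 2 * ((q + 2) / (q + 1) ^+ 2)).
  by field; rewrite gt_eqF.
rewrite oppr_ge0 pmulr_lle0; last by rewrite divr_gt0 ?exprn_gt0 //; lra.
by move=> b2; apply/eqP; rewrite -sqrf_eq0 eq_le b2 sqr_ge0.
Qed.

End GroundState.

(** * A maximum bound for the ground state *)

Lemma sqr_sum_le (R : realDomainType) n (a : 'I_n -> R) :
  (\sum_k a k) ^+ 2 <= n%:R * \sum_k a k ^+ 2.
Proof.
rewrite -subr_ge0 -(pmulr_rge0 _ (ltr0n R 2)).
have -> : 2 * (n%:R * (\sum_k a k ^+ 2) - (\sum_k a k) ^+ 2) =
    \sum_k \sum_l (a k - a l) ^+ 2.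
  transitivity (\sum_k \sum_l (a k ^+ 2 + a l ^+ 2 - 2 * (a k * a l))).
    transitivity (\sum_k (n%:R * a k ^+ 2 + \sum_l a l ^+ 2
        - 2 * (a k * \sum_l a l))).
      rewrite sumrB big_split /= sumr_const card_ord -!big_distrr -big_distrl /=.
      by rewrite -mulr_natl; ring.
    apply: eq_bigr => k _; rewrite sumrB big_split /= sumr_const card_ord.
    by rewrite [n%:R * _]mulr_natl -!big_distrr.
  by apply: eq_bigr => k _; apply: eq_bigr => l _; ring.
by apply: sumr_ge0 => k _; apply: sumr_ge0 => l _; exact: sqr_ge0.
Qed.

Section Translations.
Context (R : realFieldType) (B : finZmodType).
Implicit Types (v : B -> R) (h : B).

Definition shift_energy v h : R := \sum_x (v (x + h) - v x) ^+ 2.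

Lemma sum_shift v h : \sum_x v (x + h) = \sum_x v x.
Proof. by rewrite [RHS](reindex_inj (addIr h)). Qed.

(** The difference along a sum of shifts telescopes; the Cauchy-Schwarz
    inequality and the invariance under translations bound each term. *)
Lemma shift_energy_sum v n (h : 'I_n -> B) :
  shift_energy v (\sum_k h k) <= n%:R * \sum_k shift_energy v (h k).
Proof.
pose S k := \sum_(j < n | (j < k)%N) h j.
have S_succ (k : 'I_n) : S k.+1 = S k + h k.
  rewrite /S (bigD1 k) //= addrC; congr (_ + _); apply: eq_bigl => j.
  by rewrite ltnS ltn_neqAle andbC.
have tele x : v (x + \sum_k h k) - v x =
    \sum_(k < n) (v (x + S k + h k) - v (x + S k)).
  transitivity (\sum_(0 <= k < n) (v (x + S k.+1) - v (x + S k))).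
    rewrite telescope_sumr // /S [X in _ - v (_ + X)]big1 ?addr0 //.
    by congr (v (_ + _) - _); apply: eq_bigl => j; rewrite ltn_ord.
  rewrite big_mkord; apply: eq_bigr => k _.
  by rewrite S_succ addrA.
apply: le_trans (_ : \sum_x n%:R *
    \sum_(k < n) (v (x + S k + h k) - v (x + S k)) ^+ 2 <= _).
  by apply: ler_sum => x _; rewrite tele; exact: sqr_sum_le.
rewrite -big_distrr exchange_big /=.
rewrite le_eqVlt; apply/orP; left; apply/eqP; congr (_ * _).
apply: eq_bigr => k _.
exact: (sum_shift (fun x => (v (x + h k) - v x) ^+ 2)).
Qed.

Lemma shift_energy_muln v h n :
  shift_energy v (h *+ n) <= n%:R ^+ 2 * shift_energy v h.
Proof.
have := shift_energy_sum v (fun _ : 'I_n => h).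
by rewrite !sumr_const !card_ord -[shift_energy v h *+ n]mulr_natl mulrA.
Qed.

(** Averaging the polarisation identity
    [2 |v|^2 = |v (. + h) - v|^2 + 2 <v, v (. + h)>] over [h] in [H]. *)
Lemma nash_translation v (H : {set B}) (Q : R) : H != finset.set0 ->
  (forall h, h \in H -> shift_energy v h <= Q) ->
  \sum_x v x ^+ 2 <= Q / 2 + (\sum_x `|v x|) ^+ 2 / #|H|%:R.
Proof.
rewrite -card_gt0 => H0 HQ.
have H0R : 0 < #|H|%:R :> R by rewrite ltr0n.
have polar h : \sum_x v x ^+ 2 = shift_energy v h / 2 + \sum_x v x * v (x + h).
  rewrite -[LHS](mulfK (_ : 2 != 0 :> R)) // mulr_natr mulr2n.
  rewrite -{1}(sum_shift (fun x => v x ^+ 2) h) /shift_energy -[RHS](mulfK (_ : 2 != 0 :> R)) //.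
  congr (_ / 2); rewrite mulrDl divfK // big_distrl -!big_split /=.
  by apply: eq_bigr => x _; ring.
have E : #|H|%:R * \sum_x v x ^+ 2 =
    \sum_(h in H) (shift_energy v h / 2 + \sum_x v x * v (x + h)).
  by rewrite (eq_bigr _ (fun h _ => esym (polar h))) sumr_const mulr_natl.
rewrite -(ler_pM2l H0R) {}E mulrDr [_ * (_ / #|H|%:R)]mulrC divfK ?gt_eqF //.
rewrite big_split /= lerD //.
  rewrite -mulr_natl -sumr_const.
  rewrite big_distrl /=.
  by apply: ler_sum => h hH; rewrite mul1r ler_wpM2r ?invr_ge0 // HQ.
rewrite exchange_big expr2 big_distrl; apply: ler_sum => x _ /=.
rewrite -big_distrr /=; apply: le_trans (ler_norm _) _.
rewrite normrM ler_wpM2l //; apply: le_trans (ler_norm_sum _ _ _) _.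
rewrite -(sum_shift (fun y => `|v y|) x) [leRHS](bigID (mem H)) /=.
rewrite (eq_bigr (fun h => `|v (h + x)|)) => [|h _]; last by rewrite addrC.
by rewrite lerDl sumr_ge0.
Qed.

End Translations.

Lemma card_ord_interval n a b : (b <= n)%N ->
  #|[pred j : 'I_n | (a <= j < b)%N]| = (b - a)%N.
Proof.
move=> bn; rewrite -sum1_card -(big_mkord (fun j => a <= j < b)%N (fun=> 1%N)).
rewrite -[RHS]muln1 -sum_nat_const_nat (big_nat_widen _ _ _ _ _ bn).
by rewrite (big_nat_widenl _ _ _ _ _ (leq0n a)); apply: eq_bigl => j /=;
  rewrite andbC.
Qed.

(** The box with opposite faces glued, as a finite abelian group. *)
Definition torus (d N : nat) := {ffun 'I_d -> 'I_N.+2}.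
HB.instance Definition _ d N := GRing.Zmodule.on (torus d N).
HB.instance Definition _ d N := Finite.on (torus d N).

Section NashBox.
Context (R : realType) (d N : nat).
Local Notation T := (torus d N).
Implicit Types v : T -> R.

Definition unit_step (i : 'I_d) : T := [ffun j => if j == i then 1 else 0].

Lemma decompose_shift (h : T) : h = \sum_i unit_step i *+ (h i).
Proof.
apply/ffunP => j; rewrite sum_ffunE (bigD1 j) //= big1 => [|i /negbTE ij].
  by rewrite ffunMnE ffunE eqxx addr0 natr_Zp.
by rewrite ffunMnE ffunE eq_sym ij mul0rn.
Qed.

(** Wrapping the box around to a torus is harmless for functions that vanish on
    the boundary layer. *)
Lemma shift_energy_step v i : @dirichlet_space d R N v ->
  shift_energy v (unit_step i) <=
  \sum_x \sum_(y | adj x y) (v x - v y) ^+ 2.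
Proof.
move=> Dv; apply: ler_sum => x _; set y := x + unit_step i.
have s0 : 0 <= \sum_(y | adj x y) (v x - v y) ^+ 2.
  by apply: sumr_ge0 => z _; exact: sqr_ge0.
have yj j : y j = x j + unit_step i j by rewrite ffunE.
have [ib|] := boolP (interior_box x || interior_box y); last first.
  by rewrite negb_or => /andP[/Dv vx /Dv vy]; rewrite {1}vx {1}vy subrr expr0n.
have xi : (x i <= N)%N.
  rewrite leqNgt; apply/negP => xN.
  have xiE : x i = N.+1 :> nat by apply/eqP; rewrite eqn_leq xN -ltnS ltn_ord.
  case/orP: ib => /forallP/(_ i); first by rewrite xiE ltnn andbF.
  by rewrite yj ffunE eqxx /= xiE addn1 modnn.
have xy : adj x y.
  rewrite /adj ib andbT /nn (bigD1 i) //= big1 => [|j /negbTE ji].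
    rewrite !ffunE eqxx /= modn_small;
      last by rewrite (modn_small (_ : 1 < N.+2)%N) //; lia.
    by rewrite (modn_small (_ : 1 < N.+2)%N) // addr0; lia.
  by rewrite !ffunE ji addr0 subrr.
by rewrite (bigD1 y) //= -[leLHS]sqrrN opprB lerDl sumr_ge0 // => z _;
  exact: sqr_ge0.
Qed.

(** A shift with all entries below [l] is a sum of at most [d l] unit steps and
    thus costs at most [(d l)^2] times the energy. Since [l <= N + 2], the
    [l ^ d] shifts of this form are distinct elements of the torus. *)
Lemma nash_box v l : @dirichlet_space d R N v -> (0 < l <= N.+2)%N ->
  \sum_x v x ^+ 2 <=
    (d%:R * l%:R) ^+ 2 / 2 * (\sum_x \sum_(y | adj x y) (v x - v y) ^+ 2) +
    (\sum_x `|v x|) ^+ 2 / l%:R ^+ d.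
Proof.
move=> Dv /andP[l0 lN]; set S := \sum_x \sum_(y | adj x y) _.
pose H := [set h : T | h \in ffun_on [pred j : 'I_N.+2 | (j < l)%N]]%SET.
have cH : #|H| = (l ^ d)%N.
  rewrite cardsE card_ffun_on card_ord; congr (_ ^ _)%N.
  rewrite -[RHS]subn0 -(card_ord_interval 0 lN).
  exact: eq_card.
have H0 : H != finset.set0 by rewrite -card_gt0 cH expn_gt0 l0.
have S0 : 0 <= S by apply: sumr_ge0 => x _; apply: sumr_ge0 => y _;
  exact: sqr_ge0.
rewrite -natrX -cH mulrAC; apply: nash_translation => // h.
rewrite inE => /ffun_onP hl; rewrite {1}(decompose_shift h).
apply: le_trans (shift_energy_sum _ _) _.
rewrite (_ : _ * S = d%:R * (d%:R * (l%:R ^+ 2 * S))); last by ring.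
rewrite ler_wpM2l //.
apply: le_trans (_ : \sum_(i < d) l%:R ^+ 2 * S <= _).
  apply: ler_sum => i _; apply: le_trans (shift_energy_muln _ _ _) _.
  apply: ler_pM; rewrite ?sqr_ge0 ?sumr_ge0 //.
    by move=> x _; exact: sqr_ge0.
    rewrite lerXn2r ?nnegrE // ler_nat ltnW //; exact: hl.
  exact: shift_energy_step.
by rewrite sumr_const card_ord mulr_natl.
Qed.

End NashBox.

(** * The order of magnitude of the eigenvalue *)

Section TestFunction.
Context (R : realType) (d N : nat) (kappa : R) (c : environment d R).
Hypothesis kappa_ge1 : 1 <= kappa.
Hypothesis c_ell : elliptic N kappa c.
Hypothesis d_gt0 : (0 < d)%N.
Hypothesis N_gt0 : (0 < N)%N.
Local Notation box := (box d N).
Local Notation lam := (principal_eigenvalue N c).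
Implicit Types x y : box.

Let kappa_gt0 : 0 < kappa. Proof. exact: lt_le_trans kappa_ge1. Qed.

(** The sup-norm distance to the boundary layer. *)
Definition depth x : nat := N.+1 - \max_(i < d) maxn (x i) (N.+1 - x i).

Lemma depth_boundary x : ~~ interior_box x -> depth x = 0%N.
Proof.
rewrite negb_forall => /existsP[i xi]; apply/eqP; rewrite subn_eq0.
apply: leq_trans (leq_bigmax i).
by have := ltn_ord (x i); move: xi; lia.
Qed.

Lemma depth_lipschitz x y : adj x y -> (depth x <= (depth y).+1)%N.
Proof.
move=> /andP[/eqP xy _].
have close i : `|(x i : nat)%:Z - (y i : nat)%:Z| <= 1.
  rewrite -(@ler_pXn2r _ 2%N) ?nnegrE // expr1n real_normK ?num_real // -xy.
  rewrite (bigD1 i) //= !ffunE lerDl sumr_ge0 // => j _; exact: sqr_ge0.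
suff : (\max_(i < d) maxn (y i) (N.+1 - y i) <=
    (\max_(i < d) maxn (x i) (N.+1 - x i)).+1)%N by rewrite /depth; lia.
apply/bigmax_leqP => i _.
apply: (@leq_trans (maxn (x i) (N.+1 - x i)).+1); last first.
  by rewrite ltnS; exact: (leq_bigmax i).
have := close i.
set a := nat_of_ord (x i); set b := nat_of_ord (y i); lia.
Qed.

Lemma depth_ge x q : (q <= N)%N -> (forall i, q <= x i < N.+2 - q)%N ->
  (q <= depth x)%N.
Proof.
move=> qN xq; suff : (\max_(i < d) maxn (x i) (N.+1 - x i) <= N.+1 - q)%N.
  by rewrite /depth; lia.
by apply/bigmax_leqP => i _; have := xq i; lia.
Qed.

(** The function [depth] has increments at most [1] across edges and is at least
    [N / 4] on a sub-box whose side is at least a third of [N + 2]. *)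
Lemma principal_eigenvalue_le : lam <= 8 * 9 ^+ d * kappa ^+ 2 / N%:R ^+ 2.
Proof.
pose t x : R := (depth x)%:R.
have Dt : dirichlet_space t by move=> x /depth_boundary; rewrite /t => ->.
pose M : R := N.+2%:R ^+ d.
have M0 : 0 < M by rewrite exprn_gt0.
have Et : dirichlet_form c t t <= 2^-1 * (M * (3 ^+ d * kappa)).
  rewrite ler_wpM2l //;
    apply: le_trans (_ : \sum_(x : box) 3 ^+ d * kappa <= _).
    apply: ler_sum => x _; apply: le_trans (_ : \sum_(y | adj x y) kappa <= _).
      apply: ler_sum => y xy; rewrite -mulrA -[leRHS]mulr1.
      have /andP[_ ck] := c_ell xy.
      apply: ler_pM;
        rewrite ?(ltW (conductance_gt0 kappa_ge1 c_ell xy)) -?expr2 ?sqr_ge0 //.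
      rewrite -real_normK ?num_real // exprn_ile1 // /t.
      have := depth_lipschitz xy;
        have := depth_lipschitz (etrans (adjC y x) xy).
      rewrite ler_norml -!(ler_nat R) -!natr1; lra.
    rewrite sumr_const -[leLHS]mulr_natl ler_wpM2r ?(ltW kappa_gt0) //.
    by rewrite -natrX ler_nat card_adj.
  by rewrite sumr_const card_ffun !card_ord -[leLHS]mulr_natl natrX.
(* [N / 4] rounded up: positive even for [N = 1], and small enough to leave a
   third of the sites of each axis at depth at least [q]. *)
pose q := ((N + 3) %/ 4)%N.
have qN : (q <= N)%N by rewrite /q; lia.
have q4 : (N <= 4 * q)%N by rewrite /q; lia.
have cnt : (N.+2 <= 3 * (N.+2 - q - q))%N by rewrite /q; lia.
have mt : kappa^-1 * (M / 3 ^+ d * (N%:R ^+ 2 / 16)) <= norm2_sq c t.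
  apply: le_trans (norm2_sq_ge_sum kappa_ge1 c_ell d_gt0 Dt).
  rewrite ler_wpM2l ?invr_ge0 ?(ltW kappa_gt0) //.
  pose H := [set x : box | x \in ffun_on [pred j : 'I_N.+2 | (q <= j < N.+2 - q)%N]]%SET.
  have cH : #|H| = ((N.+2 - q - q) ^ d)%N.
    rewrite cardsE card_ffun_on card_ord; congr (_ ^ _)%N.
    exact/card_ord_interval/leq_subr.
  apply: le_trans (_ : \sum_(x in H) N%:R ^+ 2 / 16 <= _).
    rewrite sumr_const cH -[leRHS]mulr_natl ler_wpM2r ?divr_ge0 ?sqr_ge0 //.
    rewrite ler_pdivrMr ?exprn_gt0 // natrX -exprMn lerXn2r ?nnegrE ?mulr_ge0 //.
    by rewrite -natrM ler_nat mulnC.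
  rewrite [leRHS](bigID (mem H)) /=.
  rewrite -[leLHS]addr0 lerD ?sumr_ge0 //; last by move=> x _; exact: sqr_ge0.
  apply: ler_sum => x; rewrite inE => /ffun_onP xH.
  rewrite ler_pdivrMr // (_ : 16 = 4 ^+ 2) -?exprMn; last by ring.
  rewrite lerXn2r ?nnegrE ?mulr_ge0 // /t -natrM ler_nat.
  by have := depth_ge qN xH; lia.
have N0 : 0 < N%:R :> R by rewrite ltr0n.
have := rayleigh kappa_ge1 c_ell Dt.
have l0 : 0 <= lam by apply: (principal_eigenvalue_ge0 kappa_ge1 c_ell).
move=> /(le_trans (ler_wpM2l l0 mt))/le_trans/(_ Et).
rewrite -(_ : 3 ^+ d * 3 ^+ d = 9 ^+ d); last by rewrite -exprMn;
  congr (_ ^+ _); ring.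
set p3 : R := 3 ^+ d; have p30 : 0 < p3 by rewrite exprn_gt0.
rewrite ler_pdivlMr ?exprn_gt0 // => H.
have {}H := ler_wpM2l (ltW (mulr_gt0 (mulr_gt0 kappa_gt0 (ltr0n R 16)) (divr_gt0 p30 M0))) H.
rewrite (_ : kappa * 16 * (p3 / M) *
    (lam * (kappa^-1 * (M / p3 * (N%:R ^+ 2 / 16)))) = lam * N%:R ^+ 2) in H;
  last by field; rewrite !gt_eqF.
apply: le_trans H _; rewrite le_eqVlt; apply/orP; left; apply/eqP.
by field; rewrite gt_eqF.
Qed.

End TestFunction.

(** * Moser iteration *)

Lemma ge1Dn_le_expr (R : realFieldType) (x : R) n : 0 <= x ->
  1 + n%:R * x <= (1 + x) ^+ n.
Proof.
move=> x0; elim: n => [|n IH]; first by rewrite mul0r addr0.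
have n0 : 0 <= n%:R :> R by [].
rewrite exprS; apply: le_trans (_ : (1 + x) * (1 + n%:R * x) <= _).
  by rewrite -natr1; nra.
by rewrite ler_wpM2l //; lra.
Qed.

(** Taking roots of order [2 ^ n], the prefactor [K] disappears in the limit;
    here through Bernoulli's inequality for [a / b]. *)
Lemma le_of_expr_le (R : archiRealFieldType) (a b K : R) : 0 <= a -> 0 <= b ->
  (forall n, a ^+ (2 ^ n) <= K * b ^+ (2 ^ n)) -> a <= b.
Proof.
move=> a0 b0 ab; rewrite leNgt; apply/negP => ba.
have [b_eq0|b_gt0] := eqVneq b 0.
  have := ab 0%N; rewrite b_eq0 !expr1 mulr0; lra.
have {b0}b_gt0 : 0 < b by rewrite lt_neqAle eq_sym b_gt0.
pose x := a / b - 1.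
have x0 : 0 < x by rewrite subr_gt0 ltr_pdivlMr // mul1r.
have bound n : n%:R * x <= K.
  have n2 : (n <= 2 ^ n)%N by rewrite ltnW // ltn_expl.
  have := ab n; rewrite -ler_pdivrMr ?exprn_gt0 // -expr_div_n.
  apply: le_trans; rewrite (_ : a / b = 1 + x); last by rewrite /x; ring.
  apply: le_trans (ge1Dn_le_expr (2 ^ n) (ltW x0)).
  have : n%:R * x <= (2 ^ n)%:R * x by rewrite ler_wpM2r ?(ltW x0) // ler_nat.
  lra.
have := bound (Num.bound `|K / x|).
have := archi_boundP (normr_ge0 (K / x)); have := ler_norm (K / x).
move=> h1 h2; have := le_lt_trans h1 h2; rewrite ltr_pdivrMr //; lra.
Qed.

(** The pointwise inequality behind Moser's iteration: testing the equation
    against [u ^ (2p - 1)] controls the energy of [u ^ p]. *)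
Lemma expr_diff_le (R : realDomainType) (a b : R) p : 0 <= a -> 0 <= b -> (0 < p)%N ->
  (a ^+ p - b ^+ p) ^+ 2 <=
  p%:R ^+ 2 * ((a - b) * (a ^+ (2 * p).-1 - b ^+ (2 * p).-1)).
Proof.
case: p => // p; wlog ab : a b / b <= a => [hw|] a0 b0 _.
  have [ba|/ltW ab] := leP b a; first exact: hw.
  rewrite -sqrrN opprB -[X in _ <= _ * X]mulrNN !opprB; exact: hw.
have -> : ((2 * p.+1).-1 = (p + p).+1)%N by lia.
have d0 : 0 <= a - b by rewrite subr_ge0.
have lower : (a - b) * a ^+ (p + p) <= a ^+ (p + p).+1 - b ^+ (p + p).+1.
  rewrite !exprS mulrBl lerB // ler_wpM2l // lerXn2r ?nnegrE //.
have upper : a ^+ p.+1 - b ^+ p.+1 <= p.+1%:R * ((a - b) * a ^+ p).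
  rewrite subrXX [leRHS]mulrCA ler_wpM2l //.
  apply: le_trans (_ : \sum_(i < p.+1) a ^+ p <= _).
    apply: ler_sum => i _;
      rewrite /= -[X in _ <= a ^+ X](subnK (_ : i <= p)%N);
        last by rewrite -ltnS.
    by rewrite exprD ler_wpM2l ?exprn_ge0 // lerXn2r ?nnegrE.
  by rewrite sumr_const card_ord mulr_natl.
have up0 : 0 <= a ^+ p.+1 - b ^+ p.+1 by rewrite subr_ge0 lerXn2r ?nnegrE.
apply: le_trans (_ : (p.+1%:R * ((a - b) * a ^+ p)) ^+ 2 <= _).
  by rewrite lerXn2r ?nnegrE // (le_trans up0).
rewrite exprMn ler_wpM2l ?sqr_ge0 // exprMn -exprM muln2 -addnn expr2 -mulrA.
by rewrite ler_wpM2l.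
Qed.

Section MoserIteration.
Context (R : realType) (d N : nat) (kappa : R) (c : environment d R).
Hypothesis kappa_ge1 : 1 <= kappa.
Hypothesis c_ell : elliptic N kappa c.
Hypothesis d_gt0 : (0 < d)%N.
Hypothesis N_gt0 : (0 < N)%N.
Local Notation box := (box d N).
Local Notation D := (@dirichlet_space d R N).
Local Notation lam := (principal_eigenvalue N c).
Implicit Types (x y : box) (v : box -> R).
Context (u : box -> R).
Hypothesis Du : D u.
Hypothesis u_ge0 : forall x, 0 <= u x.
Hypothesis u_norm1 : norm2_sq c u = 1.
Hypothesis u_min : dirichlet_form c u u = lam.

Let kappa_gt0 : 0 < kappa. Proof. exact: lt_le_trans kappa_ge1. Qed.

Let D_expr p : (0 < p)%N -> D (fun x => u x ^+ p).
Proof. by move=> p0 x /Du->; rewrite expr0n gtn_eqF. Qed.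

Lemma dirichlet_form_expr p : (0 < p)%N ->
  dirichlet_form c (fun x => u x ^+ p) (fun x => u x ^+ p) <=
  p%:R ^+ 2 * (lam * (3 ^+ d * kappa * \sum_x u x ^+ (2 * p))).
Proof.
move=> p0.
apply: le_trans (_ : p%:R ^+ 2 *
    dirichlet_form c u (fun x => u x ^+ (2 * p).-1) <= _).
  rewrite /dirichlet_form [leRHS]mulrCA ler_wpM2l // big_distrr.
  apply: ler_sum => x _; rewrite big_distrr; apply: ler_sum => y xy /=.
  rewrite -mulrA -expr2 -[X in _ <= _ * X]mulrA [leRHS]mulrCA ler_wpM2l //.
    exact/ltW/(conductance_gt0 kappa_ge1 c_ell).
  exact: expr_diff_le.
rewrite ler_wpM2l ?sqr_ge0 //.
rewrite (euler_lagrange kappa_ge1 c_ell Du u_norm1 u_min);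
  last by apply: D_expr; lia.
rewrite ler_wpM2l ?(principal_eigenvalue_ge0 kappa_ge1 c_ell) //.
rewrite [X in _ <= _ * X](bigID (@interior_box d N)) /= mulrDr -[leLHS]addr0 lerD //.
  rewrite big_distrr; apply: ler_sum => x ix /=.
  rewrite -exprS prednK ?muln_gt0 // mulrC ler_wpM2r ?exprn_ge0 //.
  exact: (site_weight_le kappa_ge1 c_ell).
by rewrite !mulr_ge0 ?exprn_ge0 ?(ltW kappa_gt0) // sumr_ge0 // => x _;
  rewrite exprn_ge0.
Qed.

Lemma gradient_le_dirichlet_form v :
  \sum_x \sum_(y | adj x y) (v x - v y) ^+ 2 <= 2 * kappa * dirichlet_form c v v.
Proof.
have -> : 2 * kappa * dirichlet_form c v v = kappa *
    \sum_x \sum_(y | adj x y) c (bedge x y) * (v x - v y) * (v x - v y).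
  by rewrite /dirichlet_form; field.
rewrite big_distrr; apply: ler_sum => x _; rewrite big_distrr.
apply: ler_sum => y xy /=; rewrite -mulrA -expr2 mulrA -[leLHS]mul1r.
rewrite ler_wpM2r ?sqr_ge0 //.
have /andP[ck _] := c_ell xy.
by rewrite -ler_pdivrMl // mulr1.
Qed.

(** A natural number whose square dominates the constant of the energy term. *)
Definition moser_scale : nat :=
  (Num.bound (d%:R ^+ 2 * kappa ^+ 2 * 3 ^+ d * (8 * 9 ^+ d * kappa ^+ 2) * 2)).+1.
Local Notation Gam := moser_scale.

(** Nash's inequality at the scale [l = N / (Gam p)], where the energy term is at
    most half of the left-hand side; for [p] so large that [l] vanishes, the
    trivial bound of an l2 norm by an l1 norm takes over. *)
Lemma moser_step p : (0 < p)%N ->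
  \sum_x u x ^+ (2 * p) <=
  2 * (2 * Gam%:R * p%:R / N%:R) ^+ d * (\sum_x u x ^+ p) ^+ 2.
Proof.
move=> p0; set A := \sum_x u x ^+ (2 * p); set A' := \sum_x u x ^+ p.
have N0 : 0 < N%:R :> R by rewrite ltr0n.
have G0 : 0 < Gam%:R :> R by rewrite ltr0n.
have p0R : 0 < p%:R :> R by rewrite ltr0n.
have A'0 : 0 <= A' by apply: sumr_ge0 => x _; rewrite exprn_ge0.
have A0 : 0 <= A by apply: sumr_ge0 => x _; rewrite exprn_ge0.
have AE : A = \sum_x (u x ^+ p) ^+ 2.
  by apply: eq_bigr => x _; rewrite -exprM mulnC.
have GG : d%:R ^+ 2 * kappa ^+ 2 * 3 ^+ d * (8 * 9 ^+ d * kappa ^+ 2) * 2 <= Gam%:R ^+ 2 :> R.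
  apply: le_trans (_ : Gam%:R <= _); last by rewrite expr2 ler_peMl // ler1n.
  apply: ltW; apply: lt_le_trans (archi_boundP _) _; last by rewrite ler_nat.
  by rewrite !mulr_ge0 ?exprn_ge0 // ltW.
pose l := (N %/ (Gam * p))%N.
have [l0|l0] := posnP l.
  have NG : N%:R <= Gam%:R * p%:R :> R.
    rewrite -natrM ler_nat ltnW // ltnNge -divn_gt0 ?muln_gt0 //.
    by rewrite -/l l0.
  apply: le_trans (_ : 1 * A' ^+ 2 <= _).
    rewrite mul1r AE expr2 /A' big_distrl; apply: ler_sum => x _ /=.
    rewrite expr2 ler_wpM2l ?exprn_ge0 // (bigD1 x) //= lerDl sumr_ge0 //.
    by move=> y _; rewrite exprn_ge0.
  rewrite ler_wpM2r ?sqr_ge0 //.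
  apply: le_trans (_ : 2 * 1 <= _); first lra.
  rewrite ler_wpM2l // exprn_ege1 // ler_pdivlMr //; lra.
have lN : (l <= N.+2)%N by rewrite (leq_trans (leq_div _ _)) // ltnW.
have nash := @nash_box R d N (fun x => u x ^+ p) l (D_expr p0).
rewrite l0 lN in nash; have {nash} := nash isT.
have absE : \sum_x `|u x ^+ p| = A'.
  by apply: eq_bigr => x _; rewrite ger0_norm ?exprn_ge0.
rewrite -AE absE; set S := \sum_x \sum_(y | adj x y) _ => nash.
have SA : S <= 2 * kappa * (p%:R ^+ 2 * (8 * 9 ^+ d * kappa ^+ 2 / N%:R ^+ 2 * (3 ^+ d * kappa * A))).
  apply: le_trans (gradient_le_dirichlet_form _) _.
  rewrite ler_wpM2l ?mulr_ge0 ?(ltW kappa_gt0) //.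
  apply: le_trans (dirichlet_form_expr p0) _; rewrite ler_wpM2l ?sqr_ge0 //.
  rewrite ler_wpM2r ?(principal_eigenvalue_le kappa_ge1 c_ell) //.
  by rewrite !mulr_ge0 ?exprn_ge0 // ltW.
have l0R : 0 < l%:R :> R by rewrite ltr0n.
have lG : l%:R * (Gam%:R * p%:R) <= N%:R :> R by rewrite -!natrM ler_nat leq_divM.
have Gl : N%:R <= 2 * (l%:R * (Gam%:R * p%:R)) :> R.
  rewrite -!natrM ler_nat.
  have : (N < l.+1 * (Gam * p))%N by rewrite ltn_ceil // muln_gt0.
  have := leq_pmull (Gam * p) l0; rewrite mulSn mul2n -addnn.
  by move=> h1 /ltnW/leq_trans; apply; rewrite leq_add2r.
have energy : (d%:R * l%:R) ^+ 2 / 2 * S <= A / 2.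
  apply: le_trans (ler_wpM2l _ SA) _; first by rewrite divr_ge0 ?sqr_ge0.
  have -> : (d%:R * l%:R) ^+ 2 / 2 * (2 * kappa * (p%:R ^+ 2 *
      (8 * 9 ^+ d * kappa ^+ 2 / N%:R ^+ 2 * (3 ^+ d * kappa * A)))) =
      (d%:R ^+ 2 * kappa ^+ 2 * 3 ^+ d * (8 * 9 ^+ d * kappa ^+ 2) * 2) *
      ((l%:R * p%:R / N%:R) ^+ 2 * (A / 2)).
    by field; rewrite gt_eqF.
  apply: le_trans (ler_wpM2r _ GG) _;
    first by rewrite mulr_ge0 ?sqr_ge0 // divr_ge0.
  rewrite mulrA -exprMn -[leRHS]mul1r ler_wpM2r ?divr_ge0 // exprn_ile1 //.
  by rewrite mulrA ler_pdivrMr // mul1r mulrCA.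
have {nash energy}half : A <= 2 * (A' ^+ 2 / l%:R ^+ d) by lra.
apply: le_trans half _; rewrite -[leRHS]mulrA ler_wpM2l // mulrC.
rewrite ler_wpM2r ?sqr_ge0 // -exprVn lerXn2r ?nnegrE ?invr_ge0 //.
rewrite ler_pdivlMr // ler_pdivrMl //; lra.
Qed.

(** Along [p = 2 ^ k] the constant of [moser_step] grows like [(2 ^ d) ^ k]. This
    growth is absorbed by rescaling the sums with the factor [Q ^ (k + 1)], which
    turns the recursion into [G (k + 1) <= G k ^ 2], and [G 1] is explicit thanks
    to the normalisation of [u]. *)
Theorem ground_state_bound x :
  u x ^+ 2 <= 2 * (2 * Gam%:R) ^+ d * 4 ^+ d * kappa / N%:R ^+ d.
Proof.
have N0 : 0 < N%:R :> R by rewrite ltr0n.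
have G0 : 0 < Gam%:R :> R by rewrite ltr0n.
pose A k := \sum_x u x ^+ (2 ^ k).
pose B : R := 2 * (2 * Gam%:R) ^+ d / N%:R ^+ d.
pose Q : R := 2 ^+ d.
have B0 : 0 < B by rewrite divr_gt0 ?mulr_gt0 ?exprn_gt0 ?mulr_gt0.
have Q1 : 1 <= Q by rewrite exprn_ege1 //; lra.
have A0 k : 0 <= A k by apply: sumr_ge0 => y _; rewrite exprn_ge0.
have rec k : A k.+1 <= B * Q ^+ k * A k ^+ 2.
  rewrite /A expnS; apply: le_trans (moser_step _) _; first by rewrite expn_gt0.
  rewrite ler_wpM2r ?sqr_ge0 // le_eqVlt; apply/orP; left; apply/eqP.
  by rewrite natrX expr_div_n !exprMn /B /Q -!exprM [(k * d)%N]mulnC exprMn;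
    ring.
pose G k := B * Q ^+ k.+1 * A k.
have G_ge0 k : 0 <= G k by rewrite !mulr_ge0 ?exprn_ge0 // ?(ltW B0) // (le_trans _ Q1).
have recG k : G k.+1 <= G k ^+ 2.
  rewrite /G; apply: le_trans (ler_wpM2l _ (rec k)) _.
    by rewrite mulr_ge0 ?exprn_ge0 ?(ltW B0) // (le_trans _ Q1).
  rewrite le_eqVlt; apply/orP; left; apply/eqP.
  by rewrite !exprS; ring.
have GG k : G k.+1 <= G 1%N ^+ (2 ^ k).
  elim: k => [|k IH]; first by rewrite expr1.
  apply: le_trans (recG _) _;
    rewrite expnSr exprM lerXn2r ?nnegrE ?exprn_ge0 //.
have A1 : A 1%N <= kappa.
  have := norm2_sq_ge_sum kappa_ge1 c_ell d_gt0 Du.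
  by rewrite u_norm1 mulrC ler_pdivrMr // mul1r.
apply: le_trans (_ : G 1%N <= _); last first.
  rewrite /G /B /Q -exprM mulnC exprM.
  rewrite (_ : 2 ^+ 2 = 4) //; last by ring.
  rewrite [leRHS](_ : _ = 2 * (2 * Gam%:R) ^+ d / N%:R ^+ d * 4 ^+ d * kappa).
    by rewrite ler_wpM2l // !mulr_ge0 ?invr_ge0 ?exprn_ge0 // mulr_ge0.
  by field; rewrite expf_neq0 // gt_eqF.
apply: (@le_of_expr_le _ _ _ B^-1) => // [|n]; first exact: sqr_ge0.
rewrite -exprM -expnS.
apply: le_trans (_ : A n.+1 <= _).
  by rewrite /A (bigD1 x) //= lerDl sumr_ge0 // => y _; rewrite exprn_ge0.
apply: le_trans (_ : B^-1 * G n.+1 <= _);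
  last by rewrite ler_wpM2l ?invr_ge0 ?(ltW B0).
rewrite /G -[B * _ * _]mulrA mulKf ?gt_eqF // ler_peMl // exprn_ege1 //.
Qed.

End MoserIteration.

(** * Sensitivity of the eigenvalue to one conductance *)

Section Edges.
Context (R : realType) (d N : nat).
Local Notation box := (box d N).
Implicit Types (x y : box) (u : box -> R) (c : environment d R).

Definition box_edges : {fset {fset site d}} :=
  [fset bedge p.1 p.2 | p in [pred p : box * box | adj p.1 p.2]]%fset.

Lemma box_edgesP e :
  reflect (exists x y, adj x y /\ e = bedge x y) (e \in box_edges).
Proof.
apply: (iffP idP) => [/imfsetP[[x y] /= xy ->]|[x [y [xy ->]]]].
  by exists x, y.
by apply/imfsetP; exists (x, y).
Qed.

Lemma bedge_in x y : adj x y -> bedge x y \in box_edges.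
Proof. by move=> xy; apply/box_edgesP; exists x, y. Qed.

Lemma box_edges_lattice e : e \in box_edges -> lattice_edges e.
Proof. by move=> /box_edgesP[x [y [xy ->]]]; exact: adj_lattice. Qed.

Definition edge_energy u (e : {fset site d}) : R :=
  2^-1 * \sum_x \sum_(y | adj x y && (bedge x y == e)) (u x - u y) ^+ 2.

Definition edge_mass u (e : {fset site d}) : R :=
  \sum_(x | interior_box x) \sum_(y | adj x y && (bedge x y == e)) u x ^+ 2.

(** Grouping ordered pairs by their edge exhibits both quadratic forms as linear
    functions of the conductances. *)
Lemma sum_by_edges (P : pred box) c (h : box -> box -> R) :
  \sum_(x | P x) \sum_(y | adj x y) c (bedge x y) * h x y =
  \sum_(e <- box_edges)
    c e * \sum_(x | P x) \sum_(y | adj x y && (bedge x y == e)) h x y.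
Proof.
under [RHS]eq_bigr do rewrite big_distrr /=.
rewrite exchange_big; apply: eq_bigr => x _ /=.
under [RHS]eq_bigr do rewrite big_distrr /= big_mkcondr.
rewrite exchange_big; apply: eq_bigr => y xy /=.
rewrite (bigD1_seq (bedge x y)) ?bedge_in ?fset_uniq //= eqxx.
by rewrite big1 ?addr0 // => e; rewrite eq_sym => /negbTE ->.
Qed.

Lemma dirichlet_form_edges c u :
  dirichlet_form c u u = \sum_(e <- box_edges) c e * edge_energy u e.
Proof.
transitivity (2^-1 * \sum_(x : box) \sum_(y | adj x y)
    c (bedge x y) * (u x - u y) ^+ 2).
  congr (_ * _); apply: eq_bigr => x _; apply: eq_bigr => y _.
  by rewrite -mulrA -expr2.
rewrite (sum_by_edges predT) big_distrr; apply: eq_bigr => e _ /=.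
by rewrite mulrCA.
Qed.

Lemma norm2_sq_edges c u :
  norm2_sq c u = \sum_(e <- box_edges) c e * edge_mass u e.
Proof. by rewrite norm2_sqE sum_by_edges. Qed.

Lemma edge_energy_ge0 u e : 0 <= edge_energy u e.
Proof.
by rewrite mulr_ge0 // !sumr_ge0 // => x _; rewrite sumr_ge0 // => y _;
  exact: sqr_ge0.
Qed.

Lemma edge_mass_ge0 u e : 0 <= edge_mass u e.
Proof. by apply: sumr_ge0 => x _; rewrite sumr_ge0 // => y _;
  exact: sqr_ge0. Qed.

(** An edge arises from at most two ordered pairs of sites. *)
Lemma sum_over_edge_le (e : {fset site d}) (P : pred box) (h : box -> box -> R) (M : R) :
  (forall x y, 0 <= h x y <= M) ->
  \sum_(x | P x) \sum_(y | adj x y && (bedge x y == e)) h x y <= 2 * M.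
Proof.
move=> hM; have M0 : 0 <= M.
  have /andP[h0 h1] := hM [ffun=> ord0] [ffun=> ord0]; exact: le_trans h0 h1.
pose Q (p : box * box) := [&& P p.1, adj p.1 p.2 & bedge p.1 p.2 == e].
rewrite pair_big_dep /=.
apply: le_trans (_ : \sum_(p | Q p) M <= _).
  by apply: ler_sum => p _; have /andP[] := hM p.1 p.2.
rewrite sumr_const -[leLHS]mulr_natl ler_wpM2r // ler_nat.
have [[x0 y0]|] := pickP Q; last first.
  by move=> Q0; rewrite eq_card0.
move=> /and3P[_ _ /eqP e0].
have sub : {subset Q <= pred2 (x0, y0) (y0, x0)}.
  move=> [x y] /and3P[_ _ /eqP xye]; rewrite !inE !xpair_eqE.
  have := bedge_inj (etrans xye (esym e0)).
  by move=> /= [[-> ->]|[-> ->]]; rewrite !eqxx ?orbT.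
apply: (@leq_trans #|pred2 (x0, y0) (y0, x0)|);
  first exact/subset_leq_card/fintype.subsetP.
by rewrite card2; case: eqP.
Qed.

End Edges.

Section Perturbation.
Context (R : realType) (d N : nat) (kappa : R).
Hypothesis kappa_ge1 : 1 <= kappa.
Hypothesis d_gt0 : (0 < d)%N.
Hypothesis N_gt0 : (0 < N)%N.
Local Notation box := (box d N).
Local Notation lam := (principal_eigenvalue N).
Implicit Types (x y : box) (u : box -> R) (c : environment d R).

Let kappa_gt0 : 0 < kappa. Proof. exact: lt_le_trans kappa_ge1. Qed.

Lemma ellipticE c e : elliptic N kappa c -> e \in box_edges d N ->
  kappa^-1 <= c e <= kappa.
Proof. by move=> ell /box_edgesP[x [y [/ell + ->]]]. Qed.

(** If all conductances change by a factor of at most [theta], so do both the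
    energy and the squared norm, hence the square in the bound. *)
Lemma principal_eigenvalue_scale c c' (theta : R) : 1 <= theta ->
  elliptic N kappa c -> elliptic N kappa c' ->
  (forall e, e \in box_edges d N -> c' e <= theta * c e) ->
  (forall e, e \in box_edges d N -> c e <= theta * c' e) ->
  lam c' <= theta ^+ 2 * lam c.
Proof.
move=> theta1 ell ell' cc' c'c.
have theta0 : 0 < theta by exact: lt_le_trans theta1.
have [u [Du _ u1 ulam]] := exists_minimizer kappa_ge1 ell d_gt0 N_gt0.
have E' : dirichlet_form c' u u <= theta * lam c.
  rewrite -ulam !dirichlet_form_edges big_distrr big_seq [leRHS]big_seq.
  apply: ler_sum => e ee /=; rewrite mulrA ler_wpM2r ?edge_energy_ge0 //;
    exact: cc'.
have m' : 1 <= theta * norm2_sq c' u.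
  rewrite -u1 !norm2_sq_edges big_distrr big_seq [leRHS]big_seq.
  apply: ler_sum => e ee /=; rewrite mulrA ler_wpM2r ?edge_mass_ge0 //;
    exact: c'c.
have := rayleigh kappa_ge1 ell' Du.
have l0 := principal_eigenvalue_ge0 kappa_ge1 ell'.
move=> /le_trans/(_ E') /(ler_wpM2l (ltW theta0)) H.
rewrite expr2 -mulrA; apply: le_trans H.
by rewrite mulrCA -[leLHS]mulr1 ler_wpM2l.
Qed.

(** The ground state [u] of [c] serves as test function for [c']. Both forms
    change only through the edge [e], and the normalisation of [u] changes by a
    factor of at least [kappa^(-2)]. *)
Lemma principal_eigenvalue_perturb c c' e u :
  elliptic N kappa c -> elliptic N kappa c' -> e \in box_edges d N ->
  (forall e', e' \in box_edges d N -> e' != e -> c' e' = c e') ->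
  dirichlet_space u -> norm2_sq c u = 1 -> dirichlet_form c u u = lam c ->
  lam c' - lam c <= kappa ^+ 3 * (edge_energy u e + lam c * edge_mass u e).
Proof.
move=> ell ell' ee cc' Du u1 ulam.
have change (F : {fset site d} -> R) : \sum_(e' <- box_edges d N) c' e' * F e' =
    \sum_(e' <- box_edges d N) c e' * F e' + (c' e - c e) * F e.
  rewrite (bigD1_seq e) ?fset_uniq //= [X in _ = X + _](bigD1_seq e) ?fset_uniq //=.
  have -> : \sum_(i <- box_edges d N | i != e) c' i * F i =
      \sum_(i <- box_edges d N | i != e) c i * F i.
    rewrite big_seq_cond [RHS]big_seq_cond.
    by apply: eq_bigr => e' /andP[e'e ne]; rewrite cc'.
  by ring.
have E' : dirichlet_form c' u u = lam c + (c' e - c e) * edge_energy u e.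
  by rewrite -ulam !dirichlet_form_edges change.
have m' : norm2_sq c' u = 1 + (c' e - c e) * edge_mass u e.
  by rewrite -u1 !norm2_sq_edges change.
have m'_ge : kappa ^- 2 <= norm2_sq c' u.
  rewrite -[leLHS]mulr1 -u1 !norm2_sq_edges big_distrr big_seq [leRHS]big_seq.
  apply: ler_sum => e' e'e /=; rewrite mulrA ler_wpM2r ?edge_mass_ge0 //.
  have /andP[_ h1] := ellipticE ell e'e; have /andP[h2 _] := ellipticE ell' e'e.
  apply: le_trans h2;
    rewrite mulrC ler_pdivrMr ?exprn_gt0 // expr2 mulKf ?gt_eqF //.
have G0 := edge_energy_ge0 u e; have S0 := edge_mass_ge0 u e.
have l0 := principal_eigenvalue_ge0 kappa_ge1 ell.
have [le_lam|lt_lam] := leP (lam c') (lam c).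
  apply: le_trans (_ : 0 <= _); first by rewrite subr_le0.
  apply: mulr_ge0; first exact/exprn_ge0/ltW.
  by rewrite addr_ge0 // mulr_ge0.
have ray := rayleigh kappa_ge1 ell' Du; rewrite E' in ray.
have gain : (lam c' - lam c) * norm2_sq c' u <=
    kappa * (edge_energy u e + lam c * edge_mass u e).
  apply: le_trans (_ : (c' e - c e) * (edge_energy u e - lam c * edge_mass u e) <= _).
    rewrite mulrBl lerBlDr (le_trans ray) // m'; lra.
  have /andP[ce1 ce2] := ellipticE ell ee;
    have /andP[ce1' ce2'] := ellipticE ell' ee.
  have ik : 0 < kappa^-1 by rewrite invr_gt0.
  set s := lam c * edge_mass u e; have s0 : 0 <= s by rewrite mulr_ge0.
  have h1 : (c' e - c e) * edge_energy u e <= kappa * edge_energy u e.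
    by rewrite ler_wpM2r //; lra.
  have h2 : (c e - c' e) * s <= kappa * s by rewrite ler_wpM2r //; lra.
  lra.
have step : (lam c' - lam c) * kappa ^- 2 <= (lam c' - lam c) * norm2_sq c' u.
  by rewrite ler_wpM2l // subr_ge0 ltW.
have := le_trans step gain; rewrite ler_pdivrMr ?exprn_gt0 //.
by move=> /le_trans; apply; rewrite le_eqVlt; apply/orP; left; apply/eqP; ring.
Qed.

Let Lam : R := 8 * 9 ^+ d * kappa ^+ 2.
Let Sup : R := 2 * (2 * (moser_scale d kappa)%:R) ^+ d * 4 ^+ d * kappa.

(** A bound on the largest influence times a bound on the sum of all influences,
    up to powers of [N]. *)
Definition influence_const : R :=
  (kappa ^+ 3 * (4 + 2 * Lam) * Sup) * (kappa ^+ 4 * 2 * Lam).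

(** The influences sum to a multiple of [lam c], since the energy of [u] is
    [lam c] and its mass is [1], and each of them is at most a multiple of the
    maximum of [u ^ 2]. The squares are therefore summable with the product of
    the two bounds. *)
Lemma influences c : elliptic N kappa c ->
  exists L : {fset site d} -> R,
  [/\ forall e, 0 <= L e,
      forall c' e, elliptic N kappa c' -> e \in box_edges d N ->
        (forall e', e' \in box_edges d N -> e' != e -> c' e' = c e') ->
        N%:R ^+ 2 * lam c' - N%:R ^+ 2 * lam c <= L e &
      \sum_(e <- box_edges d N) L e ^+ 2 <=
        influence_const * (N%:R ^+ 2 / N%:R ^+ d)].
Proof.
move=> ell.
have [u [Du u0 u1 ulam]] := exists_minimizer kappa_ge1 ell d_gt0 N_gt0.
have N0 : 0 < N%:R :> R by rewrite ltr0n.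
have l0 := principal_eigenvalue_ge0 kappa_ge1 ell.
have lN : lam c <= Lam / N%:R ^+ 2 := principal_eigenvalue_le kappa_ge1 ell d_gt0 N_gt0.
have Lam0 : 0 <= Lam by rewrite !mulr_ge0 ?exprn_ge0 // ltW.
have lLam : lam c <= Lam.
  apply: le_trans lN _; rewrite ler_pdivrMr ?exprn_gt0 // ler_peMr //.
  by rewrite exprn_ege1 // ler1n.
pose U := Sup / N%:R ^+ d.
have uU x : u x ^+ 2 <= U by exact: (ground_state_bound kappa_ge1 ell d_gt0 N_gt0 Du u0 u1 ulam x).
pose L0 e := edge_energy u e + lam c * edge_mass u e.
have L0_ge0 e : 0 <= L0 e.
  by rewrite addr_ge0 ?edge_energy_ge0 ?mulr_ge0 ?edge_mass_ge0.
have U0 : 0 <= U by apply: le_trans (uU [ffun=> ord0]); exact: sqr_ge0.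
have L0_max e : L0 e <= (4 + 2 * Lam) * U.
  have G4 : edge_energy u e <= 4 * U.
    rewrite /edge_energy ler_pdivrMl // mulrA.
    apply: le_trans (_ : _ <= 2 * (4 * U)) _; last by lra.
    apply: sum_over_edge_le => x y; rewrite sqr_ge0 /=.
    have := uU x; have := uU y; have := sqr_ge0 (u x + u y); lra.
  have S2 : edge_mass u e <= 2 * U.
    by apply: sum_over_edge_le => x y; rewrite sqr_ge0 uU.
  have : lam c * edge_mass u e <= Lam * (2 * U).
    by apply: ler_pM => //; exact: edge_mass_ge0.
  by rewrite /L0; lra.
have L0_sum : \sum_(e <- box_edges d N) L0 e <= 2 * kappa * lam c.
  have -> : 2 * kappa * lam c =
      \sum_(e <- box_edges d N) kappa * (c e * L0 e).
    rewrite -big_distrr /= -[2 * kappa]mulrC -mulrA; congr (_ * _).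
    rewrite [RHS](eq_bigr (fun e => c e * edge_energy u e + lam c * (c e * edge_mass u e))).
      rewrite big_split -big_distrr /= -dirichlet_form_edges -norm2_sq_edges.
      by rewrite ulam u1; ring.
    by move=> e _; rewrite /L0; ring.
  rewrite big_seq [leRHS]big_seq; apply: ler_sum => e ee.
  rewrite mulrA -[leLHS]mul1r ler_wpM2r // -ler_pdivrMl // mulr1.
  by have /andP[] := ellipticE ell ee.
exists (fun e => N%:R ^+ 2 * (kappa ^+ 3 * L0 e));
  split => [e|c' e ell' ee cc'|].
- by rewrite !mulr_ge0 ?exprn_ge0 // ltW.
- rewrite -mulrBr ler_wpM2l ?sqr_ge0 //.
  exact: (principal_eigenvalue_perturb ell ell' ee cc' Du u1 ulam).
- apply: le_trans (_ : \sum_(e <- box_edges d N)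
      ((N%:R ^+ 2 * kappa ^+ 3) ^+ 2 * ((4 + 2 * Lam) * U)) * L0 e <= _).
    apply: ler_sum => e _; rewrite mulrA exprMn [L0 e ^+ 2]expr2 -[leRHS]mulrA.
    by rewrite ler_wpM2l ?sqr_ge0 // ler_wpM2r.
  have pre0 : 0 <= (N%:R ^+ 2 * kappa ^+ 3) ^+ 2 * ((4 + 2 * Lam) * U).
    by apply: mulr_ge0 (sqr_ge0 _) _; apply: mulr_ge0 => //; lra.
  rewrite -big_distrr /=; apply: le_trans (ler_wpM2l pre0 L0_sum) _.
  apply: le_trans (_ : (N%:R ^+ 2 * kappa ^+ 3) ^+ 2 * ((4 + 2 * Lam) * U) *
      (2 * kappa * (Lam / N%:R ^+ 2)) <= _).
    by rewrite (ler_wpM2l pre0) // ler_wpM2l // mulr_ge0 // ltW.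
  rewrite le_eqVlt; apply/orP; left; apply/eqP; rewrite /influence_const /U.
  by field; rewrite !expf_neq0 ?gt_eqF.
Qed.

End Perturbation.

(** * Measurability of the eigenvalue *)

Section RationalTestFunctions.
Context (R : realType) (d N : nat).
Local Notation box := (box d N).
Implicit Types (c : environment d R) (u : box -> R) (q : {ffun box -> rat}).

Definition rat_test q (x : box) : R :=
  if interior_box x then ratr (q x) else 0.

Lemma rat_test_dirichlet q : dirichlet_space (rat_test q).
Proof. by move=> x /negbTE ix; rewrite /rat_test ix. Qed.

Lemma rat_test_cvg u : dirichlet_space u ->
  exists q : nat -> {ffun box -> rat},
    forall x, rat_test (q n) x @[n --> \oo] --> u x.
Proof.
move=> Du.
have rq (n : nat) x : exists r : rat, `|u x - ratr r| < n.+1%:R^-1.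
  have /rat_in_itvoo[r] : u x - n.+1%:R^-1 < u x + n.+1%:R^-1.
    by rewrite ltrD2l gtrN // invr_gt0.
  by rewrite in_itv /= => /andP[r1 r2]; exists r; rewrite ltr_distlC r1 r2.
exists (fun n => [ffun x => xchoose (rq n x)]) => x.
rewrite /rat_test; have [ix|ix] := boolP (interior_box x); last first.
  by rewrite Du //; exact: cvg_cst.
apply/cvgrPdist_lt => e e0; near=> n; rewrite ffunE.
apply: lt_trans (xchooseP (rq n x)) _.
by near: n; exact: near_infty_natSinv_lt (PosNum e0).
Unshelve. all: by end_near. Qed.

Definition rayleigh_seq c (n : nat) : \bar R :=
  if (choice.unpickle n : option {ffun box -> rat}) is Some q then
    if 0 < norm2_sq c (rat_test q)
    then (dirichlet_form c (rat_test q) (rat_test q) / norm2_sq c (rat_test q))%:E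
    else +oo%E
  else +oo%E.

(** Normalisation turns the constraint into an open condition, so rational test
    functions suffice by density. Outside the elliptic environments the infimum
    may be over the empty set or unbounded below; [fine] sends both infinities
    to [0], the value that [inf] takes in these cases. *)
Lemma principal_eigenvalue_ratE c :
  principal_eigenvalue N c = fine (ereal_inf (range (rayleigh_seq c))).
Proof.
rewrite /principal_eigenvalue; set A := (X in inf X).
have -> : ereal_inf (range (rayleigh_seq c)) = ereal_inf (EFin @` A).
  apply/eqP; rewrite eq_le; apply/andP; split; last first.
    apply: le_ereal_inf_tmp => _ [n _ <-]; rewrite /rayleigh_seq.
    case: (choice.unpickle n) => [q|]; last exact: leey.
    case: ifPn => m0; last exact: leey.
    apply: ereal_inf_lbound; eexists; last reflexivity.
    pose k := (Num.sqrt (norm2_sq c (rat_test q)))^-1.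
    have k2 : k ^+ 2 = (norm2_sq c (rat_test q))^-1.
      by rewrite exprVn sqr_sqrtr // ltW.
    exists (fun x => k * rat_test q x);
      last by rewrite dirichlet_formZ k2 mulrC.
    split; first by move=> x ix; rewrite rat_test_dirichlet // mulr0.
    by rewrite norm2_sqZ k2 mulVf // gt_eqF.
  apply: le_ereal_inf_tmp => _ [_ [u [Du u1] <-] <-].
  apply/lee_addgt0Pr => e e0.
  have [q qu] := rat_test_cvg Du.
  have mq := @cvg_norm2_sq R nat \oo (@filter_filter _ _ eventually_filter) d N c _ _ qu.
  have Eq := @cvg_dirichlet_form R nat \oo (@filter_filter _ _ eventually_filter) d N c _ _ qu.
  have ratio : dirichlet_form c (rat_test (q n)) (rat_test (q n)) /
      norm2_sq c (rat_test (q n)) @[n --> \oo] --> dirichlet_form c u u.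
    rewrite -[X in _ --> X]divr1 -u1; apply: cvgM => //.
    by apply: cvgV => //; rewrite u1 oner_eq0.
  have m_pos : \forall n \near \oo, 0 < norm2_sq c (rat_test (q n)).
    by apply: (cvgr_gt _ mq); rewrite u1.
  have r_small : \forall n \near \oo, dirichlet_form c (rat_test (q n)) (rat_test (q n)) /
      norm2_sq c (rat_test (q n)) < dirichlet_form c u u + e.
    by apply: (cvgr_lt _ ratio); rewrite ltrDl.
  have [n [n1 n2]] : exists n, 0 < norm2_sq c (rat_test (q n)) /\
      dirichlet_form c (rat_test (q n)) (rat_test (q n)) /
      norm2_sq c (rat_test (q n)) < dirichlet_form c u u + e.
    by have [n [n1 n2]] := filter_ex (filterI m_pos r_small); exists n.
  apply: ge_ereal_inf; exists (rayleigh_seq c (choice.pickle (q n))).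
    by exists (choice.pickle (q n)).
  by rewrite /rayleigh_seq choice.pickleK n1 -EFinD lee_fin ltW.
have [A0|] := pselect (A !=set0); last first.
  move=> /set0P/negP; rewrite negbK => /eqP->.
  by rewrite image_set0 ereal_inf0 inf0.
have [lbA|nlbA] := pselect (has_lbound A); first by rewrite ereal_inf_EFin.
rewrite inf_out; last by move=> [].
suff -> : ereal_inf (EFin @` A) = -oo%E by [].
apply/eqP; rewrite -leeNy_eq leNgt; apply/negP => lt_inf.
have [r rinf] : exists r : R, (r%:E <= ereal_inf (EFin @` A))%E.
  case: (ereal_inf (EFin @` A)) lt_inf => [r| |] // _; first by exists r.
  by exists 0; exact: leey.
apply: nlbA; exists r => x Ax; rewrite -lee_fin; apply: le_trans rinf _.
by apply: ereal_inf_lbound; exists x.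
Qed.

End RationalTestFunctions.

Section Measurability.
Context (R : realType) (d N : nat) (disp : measure_display)
  (T : measurableType disp) (P : probability T R)
  (a : {fset site d} -> {RV P >-> R}).
Local Notation box := (box d N).

Let env w : environment d R := fun e => a e w.

Lemma measurable_sum_cond (I : Type) (s : seq I) (Q : pred I) (h : I -> T -> R) :
  (forall i, measurable_fun setT (h i)) ->
  measurable_fun setT (fun w => \sum_(i <- s | Q i) h i w).
Proof.
move=> mh; under eq_fun do rewrite big_mkcond.
by apply: measurable_sum => i; case: (Q i); [exact: mh | exact: measurable_cst].
Qed.

Lemma measurable_dirichlet_form (u : box -> R) :
  measurable_fun setT (fun w => dirichlet_form (env w) u u).
Proof.
apply: measurable_funM => //; apply: measurable_sum => x.
apply: measurable_sum_cond => y.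
by apply: measurable_funM => //; apply: measurable_funM.
Qed.

Lemma measurable_norm2_sq (u : box -> R) :
  measurable_fun setT (fun w => norm2_sq (env w) u).
Proof.
under eq_fun do rewrite norm2_sqE.
apply: measurable_sum_cond => x; apply: measurable_sum_cond => y.
by apply: measurable_funM.
Qed.

(** The eigenvalue has to be measurable on the whole sample space, including the
    null set where ellipticity fails. *)
Lemma measurable_scaled_eigenvalue :
  measurable_fun setT (scaled_eigenvalue a N).
Proof.
apply: measurable_funM => //.
rewrite (_ : (fun w => _) = fine \o (fun w => einfs (rayleigh_seq N (env w)) 0)).
  apply: measurableT_comp; first exact: fine_measurable.
  apply: measurable_fun_einfs => n; rewrite /rayleigh_seq.
  case: (choice.unpickle n) => [q|]; last exact: measurable_cst.
  have mE := measurable_dirichlet_form (rat_test R q).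
  have mm := measurable_norm2_sq (rat_test R q).
  rewrite (_ : (fun w => _) = (fun w => if 0 < norm2_sq (env w) (rat_test R q)
      then (dirichlet_form (env w) (rat_test R q) (rat_test R q) *
            norm2_sq (env w) (rat_test R q) `^ (-1))%:E else +oo%E)).
    apply: measurable_fun_ifT => //; first exact: measurable_fun_ltr.
    apply/measurable_EFinP/measurable_funM => //.
    exact: (measurableT_comp (measurable_powR (-1)) mm).
  by apply/funext => w; case: ifP => // m0; rewrite powR_inv1 // ltW.
apply/funext => w /=; rewrite principal_eigenvalue_ratE;
  congr (fine (ereal_inf _)).
by apply/seteqP; split => _ [n _ <-]; exists n.
Qed.

End Measurability.

(** * Discretisation of independent variables *)

Lemma ge0_integral_finite_range (disp : measure_display) (T : measurableType disp)
  (R : realType) (P : probability T R) (V : finType) (Y : T -> V) (F : V -> R) :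
  (forall v, measurable (Y @^-1` [set v])) -> (forall v, 0 <= F v) ->
  (\int[P]_w (F (Y w))%:E = \sum_v (F v)%:E * P (Y @^-1` [set v]))%E.
Proof.
move=> mY F0.
transitivity (\int[P]_w (\sum_v (F v)%:E * (\1_(Y @^-1` [set v]) w)%:E))%E.
  apply: eq_integral => w _; rewrite (bigD1 (Y w)) //= indicE mem_set // mule1.
  rewrite big1 ?adde0 // => v vY; rewrite indicE memNset ?mule0 //=.
  by move=> /esym/eqP; rewrite (negbTE vY).
rewrite ge0_integral_sum //.
- apply: eq_bigr => v _;
  rewrite ge0_integralZl ?lee_fin // ?integral_indic ?setIT //.
  exact/measurable_EFinP/measurable_indic.
- move=> v; apply: emeasurable_funM; first exact: measurable_cst.
  exact/measurable_EFinP/measurable_indic.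
- by move=> v w _; rewrite mule_ge0 ?lee_fin.
Qed.

Section DiscreteLaw.
Context (disp : measure_display) (T : measurableType disp) (R : realType)
  (P : probability T R) (I : choiceType) (D : set I) (X : I -> {RV P >-> R}).
Context (s : {fset I}) (V : finType) (idx : R -> V).
Hypothesis X_indep : mutually_independent D X.
Hypothesis sD : [set` s] `<=` D.
Hypothesis m_idx : forall v, measurable (idx @^-1` [set v]).

Definition discrete_law (i : s) (v : V) : R :=
  fine (P (X (val i) @^-1` (idx @^-1` [set v]))).

Definition discretize (w : T) : {ffun s -> V} := [ffun i => idx (X (val i) w)].

Let m_fiber i v : measurable (X i @^-1` (idx @^-1` [set v])).
Proof. by rewrite -[X in measurable X]setTI; exact: measurable_funPT. Qed.

Lemma discrete_law_ge0 i v : 0 <= discrete_law i v.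
Proof. exact: fine_ge0. Qed.

Lemma discrete_law_sum1 i : \sum_v discrete_law i v = 1.
Proof.
apply: EFin_inj; rewrite -sumEFin.
transitivity (\sum_v 1%:E * P ((idx \o X (val i)) @^-1` [set v]))%E.
  by apply: eq_bigr => v _; rewrite mul1e fineK // fin_num_measure.
rewrite -(@ge0_integral_finite_range _ _ _ P V (idx \o X (val i)) (fun=> 1)) //.
  by rewrite integral_cst // mul1e; exact: probability_setT.
by move=> v; exact: m_fiber.
Qed.

Lemma discretize_fiberE (om : {ffun s -> V}) :
  discretize @^-1` [set om] = \bigcap_(i in [set` s])
    (X i @^-1` (if insub i is Some i' then idx @^-1` [set om i'] else setT)).
Proof.
apply/seteqP; split => w /= => [E i si|E].
  by rewrite insubT /= -E ffunE.
apply/ffunP => i; rewrite ffunE; have /= := E (val i) (valP i).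
by rewrite valK.
Qed.

(** Mutual independence, tested on the rounding cells of the variables indexed
    by [s]. *)
Lemma discretize_mass om : P (discretize @^-1` [set om]) = (mass discrete_law om)%:E.
Proof.
rewrite discretize_fiberE X_indep //; last first.
  by move=> i _; case: (insub i).
rewrite big_seq_fsetE /= -prodEFin; apply: eq_bigr => i _.
by rewrite valK /discrete_law fineK // fin_num_measure.
Qed.

Lemma measurable_discretize_fiber om : measurable (discretize @^-1` [set om]).
Proof.
rewrite discretize_fiberE; apply: fin_bigcap_measurable;
  first exact: finite_fset.
move=> i _; rewrite -[X in measurable X]setTI; apply: measurable_funPT => //.
by case: (insub i).
Qed.

Lemma integral_discretize (F : {ffun s -> V} -> R) : (forall om, 0 <= F om) ->
  (\int[P]_w (F (discretize w))%:E = (Ex discrete_law F)%:E)%E.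
Proof.
move=> F0; rewrite ge0_integral_finite_range //;
  last exact: measurable_discretize_fiber.
rewrite -sumEFin; apply: eq_bigr => om _.
by rewrite discretize_mass -EFinM mulrC.
Qed.

Lemma measurable_discretize (F : {ffun s -> V} -> R) :
  measurable_fun setT (fun w => F (discretize w)).
Proof.
have -> : (fun w => F (discretize w)) =
    (fun w => \sum_om F om * \1_(discretize @^-1` [set om]) w).
  apply/funext => w; rewrite (bigD1 (discretize w)) //= indicE mem_set // mulr1.
  rewrite big1 ?addr0 // => om ne; rewrite indicE memNset ?mulr0 //=.
  by move=> /esym/eqP; rewrite (negbTE ne).
apply: measurable_sum => om; apply: measurable_funM => //.
exact/measurable_indic/measurable_discretize_fiber.
Qed.

End DiscreteLaw.

(** Rounding down to a grid of mesh [delta] that starts at [1 / kappa]. Capping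
    the grid at [kappa] keeps the rounded environments elliptic. *)
Lemma rounding_grid (R : realType) (kappa delta : R) : 1 <= kappa -> 0 < delta ->
  exists (m : nat) (idx : R -> 'I_m.+1) (g : 'I_m.+1 -> R),
  [/\ forall j, measurable (idx @^-1` [set j]),
      forall j, kappa^-1 <= g j <= kappa &
      forall a, kappa^-1 <= a <= kappa -> g (idx a) <= a <= g (idx a) + delta].
Proof.
move=> k1 d0; have k0 : 0 < kappa by exact: lt_le_trans k1.
have ik : kappa^-1 <= kappa by rewrite (le_trans _ k1) // invf_le1.
pose h a := (a - kappa^-1) / delta.
pose m := Num.truncn (kappa / delta).
exists m, (fun a => inord (Num.truncn (h a))).
exists (fun j => Num.min kappa (kappa^-1 + j%:R * delta)); split.
- move=> j.
  have m_gt n : measurable [set a | (n < Num.truncn (h a))%N].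
    rewrite (_ : [set a | _] = `[kappa^-1 + n.+1%:R * delta, +oo[%classic) //.
    apply/seteqP; split => a /=; rewrite truncn_gt_nat /h in_itv /= andbT.
      by rewrite ler_pdivlMr // lerBrDl.
    by rewrite ler_pdivlMr // lerBrDl.
  have m_eq n : measurable [set a | Num.truncn (h a) = n].
    case: n => [|n].
      rewrite (_ : [set a | _] = ~` [set a | (0 < Num.truncn (h a))%N]).
        exact: measurableC.
      by apply/seteqP; split => a /=; [move=> -> | case: Num.truncn => // ? []].
    rewrite (_ : [set a | _] = [set a | (n < Num.truncn (h a))%N] `&`
        ~` [set a | (n.+1 < Num.truncn (h a))%N]).
      by apply: measurableI => //; exact: measurableC.
    by apply/seteqP; split => a /= => [->|[h1 /negP]]; [split => //;
      rewrite ltnn | lia].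
  rewrite (_ : _ @^-1` _ = \bigcup_(n in [set n | inord n = j])
      [set a | Num.truncn (h a) = n]); first exact: bigcup_measurable.
  by apply/seteqP; split => a /= => [E|[n /= <- ->]] //;
    exists (Num.truncn (h a)).
- move=> j; rewrite le_min ik ge_min lexx /= lerDl andbT.
  by rewrite mulr_ge0 // ltW.
- move=> a /andP[a1 a2].
  have h0 : 0 <= h a by rewrite divr_ge0 ?subr_ge0 // ltW.
  have hm : (Num.truncn (h a) < m.+1)%N.
    rewrite ltnS le_truncn // ler_pM2r ?invr_gt0 //.
    by have : 0 < kappa^-1 by [rewrite invr_gt0]; lra.
  have /andP[t1 t2] := truncn_itv h0; rewrite inordK //.
  rewrite ler_pdivlMr // in t1; rewrite ltr_pdivrMr // -natr1 in t2.
  rewrite min_r; last by lra.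
  by apply/andP; split; lra.
Qed.

(** * Transfer to the random conductances *)

Lemma expectation_close (disp : measure_display) (T : measurableType disp)
  (R : realType) (P : probability T R) (f Y : T -> R) (M eta : R) :
  measurable_fun setT f -> measurable_fun setT Y -> (forall w, 0 <= Y w) ->
  0 <= eta -> {ae P, forall w, `|f w - Y w| <= eta} ->
  (\int[P]_w (Y w)%:E = M%:E)%E ->
  exists2 m, ('E_P[f] = m%:E)%E & `|m - M| <= eta.
Proof.
move=> mf mY Y0 eta0 fY EY.
(* The clamped function agrees with [f] almost surely and stays close to [Y]
   everywhere. *)
pose h w := Num.min (Y w + 2 * eta) (Num.max (Y w) (f w + eta)).
have mh : measurable_fun setT h.
  apply: measurable_minr; first exact: measurable_funD.
  by apply: measurable_maxr => //; exact: measurable_funD.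
have hY w : Y w <= h w <= Y w + 2 * eta.
  by rewrite /h le_min ge_min lexx le_max lexx /= lerDl mulr_ge0.
have h0 w : 0 <= h w by have /andP[+ _] := hY w; exact: le_trans.
have fh : {ae P, forall w, f w = h w - eta}.
  apply: filterS fY => w; rewrite ler_norml => /andP[f1 f2].
  rewrite /h max_r; last by lra.
  by rewrite min_r; lra.
have E2 : (\int[P]_w (Y w + 2 * eta)%:E = (M + 2 * eta)%:E)%E.
  under eq_integral do rewrite EFinD.
  rewrite ge0_integralD //; first last.
  - by move=> w _; rewrite lee_fin mulr_ge0.
  - exact/measurable_EFinP.
  - by move=> w _; rewrite lee_fin.
  rewrite EY integral_cst // EFinD; congr (_ + _)%E.
  by rewrite [X in (_ * X)%E]probability_setT mule1.
have h_lo : (M%:E <= \int[P]_w (h w)%:E)%E.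
  rewrite -EY; apply: ge0_le_integral => //.
  - by move=> w _; rewrite lee_fin.
  - exact/measurable_EFinP.
  - exact/measurable_EFinP.
  - by move=> w _; rewrite lee_fin; have /andP[] := hY w.
have h_hi : (\int[P]_w (h w)%:E <= (M + 2 * eta)%:E)%E.
  rewrite -E2; apply: ge0_le_integral => //.
  - by move=> w _; rewrite lee_fin.
  - exact/measurable_EFinP.
  - by apply/measurable_EFinP; exact: measurable_funD.
  - by move=> w _; rewrite lee_fin; have /andP[] := hY w.
have h_fin : (\int[P]_w (h w)%:E)%E \is a fin_num.
  rewrite ge0_fin_numE; first exact: le_lt_trans h_hi (ltry _).
  by apply: integral_ge0 => w _; rewrite lee_fin.
have h_int : P.-integrable setT (EFin \o h).
  apply/integrableP; split; first exact/measurable_EFinP.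
  under eq_integral do rewrite /= ger0_norm //.
  by rewrite -ge0_fin_numE //; apply: integral_ge0 => w _; rewrite lee_fin.
have eta_int : P.-integrable setT (EFin \o cst eta).
  exact: finite_measure_integrable_cst.
exists (fine (\int[P]_w (h w)%:E)%E - eta).
  rewrite unlock (ae_eq_integral (EFin \o (h \- cst eta))) //; first last.
  - by apply: filterS fh => w /= -> _.
  - by apply/measurable_EFinP; exact: measurable_funB.
  - exact/measurable_EFinP.
  rewrite EFinB fineK //.
  rewrite (integralB_EFin measurableT h_int eta_int); congr (_ - _)%E.
  by have := expectation_cst P eta; rewrite unlock.
rewrite -(fineK h_fin) !lee_fin in h_lo h_hi.
by rewrite ler_norml; apply/andP; split; lra.
Qed.

Section Estimates.
Context (R : realType) (d N : nat) (kappa : R).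
Hypothesis kappa_ge1 : 1 <= kappa.
Hypothesis d_gt0 : (0 < d)%N.
Hypothesis N_gt0 : (0 < N)%N.
Context (disp : measure_display) (T : measurableType disp)
  (P : probability T R) (a : {fset site d} -> {RV P >-> R}).
Hypothesis a_indep : mutually_independent (@lattice_edges d) a.
Hypothesis a_ell : forall e, lattice_edges e ->
  {ae P, forall w, kappa^-1 <= a e w <= kappa}.
Context (sigma : R).
Hypothesis sigma_gt0 : 0 < sigma.
Hypothesis sigma_sqr :
  influence_const d kappa * (N%:R ^+ 2 / N%:R ^+ d) <= sigma ^+ 2.

Local Notation f := (scaled_eigenvalue a N).
Local Notation lam := (principal_eigenvalue N).

Let kappa_gt0 : 0 < kappa. Proof. exact: lt_le_trans kappa_ge1. Qed.

Lemma ae_elliptic : {ae P, forall w, elliptic N kappa (fun e => a e w)}.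
Proof.
apply: filter_forall => x; apply: filter_forall => y.
have [xy|_] := boolP (adj x y); last exact: nearW.
by apply: filterS (a_ell (adj_lattice xy)).
Qed.

(** [(1 + x)^2 - 1 <= 3 x] for [x <= 1], multiplied by the upper bound on
    [N^2 lam]. *)
Lemma scaled_eigenvalue_lipschitz (x : R) c c' : 0 <= x <= 1 ->
  elliptic N kappa c -> elliptic N kappa c' ->
  (forall e, e \in box_edges d N -> c' e <= (1 + x) * c e) ->
  (forall e, e \in box_edges d N -> c e <= (1 + x) * c' e) ->
  N%:R ^+ 2 * lam c' - N%:R ^+ 2 * lam c <= 3 * x * (8 * 9 ^+ d * kappa ^+ 2).
Proof.
move=> /andP[x0 x1] ell ell' cc' c'c.
have N0 : 0 < N%:R ^+ 2 :> R by rewrite exprn_gt0 // ltr0n.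
have theta1 : 1 <= 1 + x by lra.
have h := principal_eigenvalue_scale kappa_ge1 d_gt0 N_gt0 theta1 ell ell' cc' c'c.
have l0 := principal_eigenvalue_ge0 kappa_ge1 ell.
have := principal_eigenvalue_le kappa_ge1 ell d_gt0 N_gt0.
rewrite ler_pdivlMr // => lN.
rewrite -mulrBr; apply: le_trans (_ : N%:R ^+ 2 * (3 * x * lam c) <= _).
  rewrite ler_wpM2l ?(ltW N0) // lerBlDr; apply: le_trans h _.
  have : x ^+ 2 * lam c <= x * lam c by rewrite ler_wpM2r // expr2 ler_piMl.
  lra.
rewrite mulrCA ler_wpM2l ?mulr_ge0 //; lra.
Qed.

(** The conductances are rounded so finely that [N^2 lam] moves by at most
    [eta = sigma / 8]. This costs a factor [exp (1 / 16)] in the tail bound, which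
    turns the constant [3] of [Ex_tail] into [4], and a fraction of [sigma^2] in
    the variance. *)
Theorem eigenvalue_estimates : exists m : R,
  [/\ ('E_P[f] = m%:E)%E,
      forall tau : R, (P [set w | (tau <= `|f w - m|)%R] <=
        (4 * expR (- (tau / (4 * sigma))))%:E)%E &
      ('V_P[f] <= (3 * sigma ^+ 2)%:E)%E].
Proof.
pose eta := sigma / 8.
have eta0 : 0 < eta by rewrite divr_gt0.
pose Lam : R := 8 * 9 ^+ d * kappa ^+ 2.
have Lam0 : 0 < Lam by rewrite !mulr_gt0 ?exprn_gt0.
pose x : R := Num.min 1 (eta / (3 * Lam)).
have x0 : 0 < x by rewrite lt_min ltr01 divr_gt0 // mulr_gt0.
have x1 : x <= 1 by rewrite ge_min lexx.
have xeta : 3 * x * Lam <= eta.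
  have : x <= eta / (3 * Lam) by rewrite ge_min lexx orbT.
  by rewrite ler_pdivlMr ?mulr_gt0 //; lra.
have delta0 : 0 < x / kappa by rewrite divr_gt0.
have [m [idx [g [m_idx g_ell g_round]]]] := rounding_grid kappa_ge1 delta0.
pose J := box_edges d N.
pose V : finType := 'I_m.+1.
pose env (om : {ffun J -> V}) : environment d R :=
  fun e => if insub e is Some i then g (om i) else 1.
have env_ell om : elliptic N kappa (env om).
  move=> y z yz; rewrite /env; case: (insub _) => [i|]; first exact: g_ell.
  by rewrite kappa_ge1 invf_le1 // kappa_ge1.
pose Z om : R := N%:R ^+ 2 * lam (env om).
have Z0 om : 0 <= Z om.
  by rewrite mulr_ge0 ?sqr_ge0 // (principal_eigenvalue_ge0 kappa_ge1 (env_ell om)).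
have [L LP] := choice (fun om => influences kappa_ge1 d_gt0 N_gt0 (env_ell om)).
have L0 (i : J) om : 0 <= L om (val i) by have [] := LP om.
have ZL (i : J) om v : Z (upd om i v) - Z om <= L om (val i).
  have [_ + _] := LP om; apply => //; first exact: valP.
  move=> e eJ /eqP ne; rewrite /env insubT /= ffunE; case: eqP => // E.
  by case: ne; rewrite -E.
have Lsigma om : \sum_(i : J) L om (val i) ^+ 2 <= sigma ^+ 2.
  have [_ _ +] := LP om; rewrite big_seq_fsetE /= => /le_trans; exact.
have JD : [set` J] `<=` @lattice_edges d.
  by move=> e /= eJ; exact: (@box_edges_lattice d N).
pose p := @discrete_law _ _ R P _ a J V idx.
have p0 := @discrete_law_ge0 _ _ R P _ a J V idx.
have p1 := @discrete_law_sum1 _ _ R P _ a J V idx m_idx.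
pose X := @discretize _ _ R P _ a J V idx.
have intX (F : {ffun J -> V} -> R) : (forall om, 0 <= F om) ->
    (\int[P]_w (F (X w))%:E = (Ex p F)%:E)%E.
  exact: (@integral_discretize _ _ R P _ _ a J V idx a_indep JD m_idx F).
have mX (F : {ffun J -> V} -> R) : measurable_fun setT (fun w => F (X w)).
  exact: (@measurable_discretize _ _ R P _ a J V idx m_idx).
have mf : measurable_fun setT f by exact: measurable_scaled_eigenvalue.
have close : {ae P, forall w, `|f w - Z (X w)| <= eta}.
  apply: filterS ae_elliptic => w ell.
  have xx : 0 <= x <= 1 by rewrite ltW.
  have round e : e \in J -> env (X w) e <= a e w <= (1 + x) * env (X w) e.
    move=> eJ; rewrite /env insubT /= ffunE /=.
    have ae := ellipticE ell eJ.
    have /andP[r1 r2] := g_round _ ae; rewrite r1 /=; apply: le_trans r2 _.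
    rewrite mulrDl mul1r lerD2l ler_wpM2l ?(ltW x0) //.
    by have /andP[] := g_ell (idx (a e w)).
  have round' e : e \in J -> env (X w) e <= (1 + x) * a e w.
    move=> eJ; have /andP[+ _] := round _ eJ; move=> /le_trans; apply.
    rewrite mulrDl mul1r lerDl mulr_ge0 ?(ltW x0) //.
    have /andP[+ _] := ellipticE ell eJ; apply: le_trans.
    by rewrite invr_ge0 ltW.
  have {}round e : e \in J -> a e w <= (1 + x) * env (X w) e.
    by move=> /round/andP[].
  rewrite ler_norml; apply/andP; split; last first.
    by apply: le_trans xeta; exact: scaled_eigenvalue_lipschitz.
  rewrite lerNl opprB; apply: le_trans xeta.
  exact: (scaled_eigenvalue_lipschitz xx ell (env_ell _)).
have [m0 Em0 m0_close] := expectation_close mf (mX Z) (fun w => Z0 (X w)) (ltW eta0) close (intX _ Z0).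
set M := Ex p Z in m0_close.
exists m0; split => // [tau|].
  have mS : measurable [set w | tau <= `|f w - m0|].
    rewrite -[X in measurable X]setTI.
    apply: (@measurable_fun_ler _ _ _ setT (cst tau) (fun w => `|f w - m0|) _ _ measurableT [set true]) => //.
    by apply: measurableT_comp => //; exact: measurable_funB.
  pose F om : R := (tau - 2 * eta <= `|Z om - M|)%R%:R.
  have F0 om : 0 <= F om by [].
  rewrite -[X in P X]setIT -integral_indic //.
  apply: le_trans (_ : \int[P]_w (F (X w))%:E <= _)%E.
    apply: ae_ge0_le_integral => //.
    - by apply/measurable_EFinP; exact: measurable_indic.
    - by move=> w _; rewrite lee_fin.
    - by apply/measurable_EFinP; exact: mX.
    apply: filterS close => w fZ _; rewrite lee_fin indicE.
    case: (boolP (w \in _)) => //; rewrite inE /= => tauf.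
    rewrite /F; suff -> : tau - 2 * eta <= `|Z (X w) - M| by [].
    have := ler_distD (Z (X w)) (f w) m0; have := ler_distD M (Z (X w)) m0.
    rewrite (distrC M m0); lra.
  rewrite intX // lee_fin;
    apply: le_trans (Ex_tail p0 p1 sigma_gt0 _ ZL Lsigma _) _ => //.
  have -> : - ((tau - 2 * eta) / (4 * sigma)) = - (tau / (4 * sigma)) + 16^-1.
    by rewrite /eta; field; rewrite gt_eqF.
  rewrite expRD mulrA mulrAC ler_wpM2r ?expR_ge0 //.
  have : expR 16^-1 <= 16 / 15 :> R.
    apply: le_trans (expR_le_inv _) _; first lra.
    by rewrite (_ : (1 - 16^-1)^-1 = 16 / 15 :> R) //; field.
  lra.
rewrite /variance unlock Em0 /= unlock.
pose F om : R := 2 * (Z om - M) ^+ 2 + 8 * eta ^+ 2.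
have F0 om : 0 <= F om.
  by apply: addr_ge0; apply: mulr_ge0 => //; exact: sqr_ge0.
apply: le_trans (_ : \int[P]_w (F (X w))%:E <= _)%E.
  apply: ae_ge0_le_integral => //.
  - by move=> w _; rewrite lee_fin /= -expr2 sqr_ge0.
  - by apply/measurable_EFinP; apply: measurable_funM; exact: measurable_funB.
  - by move=> w _; rewrite lee_fin.
  - by apply/measurable_EFinP; exact: mX.
  apply: filterS close => w fZ _; rewrite lee_fin.
  rewrite -[leLHS]/((f w - m0) * (f w - m0)) -expr2 /F.
  set u := f w - m0; set v := Z (X w) - M.
  have uv : `|u - v| <= 2 * eta.
    rewrite (_ : u - v = (f w - Z (X w)) - (m0 - M)); last by rewrite /u /v;
      ring.
    by apply: le_trans (ler_normB _ _) _; lra.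
  have : (u - v) ^+ 2 <= (2 * eta) ^+ 2.
    by rewrite -real_normK ?num_real // lerXn2r ?nnegrE // mulr_ge0 // ltW.
  have := sqr_ge0 (u - 2 * v); lra.
rewrite intX // lee_fin.
rewrite /F ExD ExZ Ex_cst //.
have := Ex_variance_le p0 p1 L0 ZL Lsigma; rewrite -/M -/p.
rewrite (_ : 8 * eta ^+ 2 = sigma ^+ 2 / 8); last by rewrite /eta; field.
have := sqr_ge0 sigma; lra.
Qed.

End Estimates.

(** * The concentration theorem *)

Lemma influence_const_gt0 (R : realType) d (kappa : R) : 1 <= kappa ->
  0 < influence_const d kappa.
Proof.
move=> k1; have k0 : 0 < kappa by exact: lt_le_trans k1.
have L0 : 0 < 8 * 9 ^+ d * kappa ^+ 2 by rewrite !mulr_gt0 ?exprn_gt0.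
have S0 : 0 < 2 * (2 * (moser_scale d kappa)%:R) ^+ d * 4 ^+ d * kappa.
  apply: mulr_gt0 => //; apply: mulr_gt0; last by rewrite exprn_gt0.
  by apply: mulr_gt0 => //; apply/exprn_gt0/mulr_gt0; rewrite ?ltr0n.
apply: mulr_gt0.
  apply: mulr_gt0 => //; apply: mulr_gt0; first exact: exprn_gt0.
  by rewrite addr_gt0 // mulr_gt0.
apply: mulr_gt0 => //; apply: mulr_gt0 => //; exact: exprn_gt0.
Qed.

Theorem theorem4 (R : realType) (d : nat) (kappa : R) :
  (3 <= d)%N -> 1 <= kappa ->
  exists C : R, 0 < C /\
    forall (disp : measure_display) (T : measurableType disp)
      (P : probability T R) (a : {fset site d} -> {RV P >-> R}),
      iid (@lattice_edges d) a ->
      (forall e, lattice_edges e ->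
         {ae P, forall w, kappa^-1 <= a e w <= kappa}) ->
      (forall (t : R) (N : nat), 0 < t -> (1 <= N)%N ->
         (P [set w | (t * N%:R `^ ((2 - d%:R) / 2))%:E
                     <= `| (scaled_eigenvalue a N w)%:E
                           - 'E_P[scaled_eigenvalue a N] |]
          <= (4 * expR (- t / C))%:E)%E) /\
      (forall N : nat, (1 <= N)%N ->
         ('V_P[scaled_eigenvalue a N] <= (C * N%:R `^ (2 - d%:R))%:E)%E).
Proof.
move=> d3 k1; have d0 : (0 < d)%N by exact: leq_trans d3.
have K00 := influence_const_gt0 d k1; set K0 := influence_const d kappa in K00.
pose K := Num.sqrt K0.
have K_gt0 : 0 < K by rewrite sqrtr_gt0.
have KK : K ^+ 2 = K0 by rewrite sqr_sqrtr // ltW.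
exists (4 * K + 3 * K0); split; first lra.
move=> disp T P a [a_indep _] a_ell.
have main N : (0 < N)%N -> let s := N%:R `^ ((2 - d%:R) / 2) in
    [/\ 0 < s, s ^+ 2 = N%:R `^ (2 - d%:R) & exists m : R,
    [/\ ('E_P[scaled_eigenvalue a N] = m%:E)%E,
      forall tau : R, (P [set w | (tau <= `|scaled_eigenvalue a N w - m|)%R] <=
        (4 * expR (- (tau / (4 * (K * s)))))%:E)%E &
      ('V_P[scaled_eigenvalue a N] <= (3 * (K * s) ^+ 2)%:E)%E]].
  move=> N0 s; have N0R : 0 < N%:R :> R by rewrite ltr0n.
  have s0 : 0 < s by rewrite powR_gt0.
  have s2 : s ^+ 2 = N%:R `^ (2 - d%:R).
    by rewrite -powR_mulrn ?(ltW s0) // /s -powRrM divfK.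
  split=> //; apply: (eigenvalue_estimates k1 d0 N0 a_indep a_ell).
    by rewrite mulr_gt0.
  rewrite exprMn KK s2 powRD; last by rewrite (gt_eqF N0R) implybT.
  by rewrite powRN !powR_mulrn // ltW.
split=> [t N t0 N0|N N0]; have [s0 s2 [m [mE tail var]]] := main N N0.
  rewrite mE; set s := _ `^ _ in s0 s2 tail *.
  have -> : [set w | ((t * s)%:E <= `|(scaled_eigenvalue a N w)%:E - m%:E|)%E] =
      [set w | t * s <= `|scaled_eigenvalue a N w - m|].
    by apply/seteqP; split => w; rewrite /mkset -EFinB lee_fin.
  apply: le_trans (tail _) _; rewrite lee_fin ler_wpM2l // ler_expR.
  rewrite mulNr lerN2.
  have -> : t * s / (4 * (K * s)) = t / (4 * K) by field; rewrite !gt_eqF.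
  rewrite ler_wpM2l ?(ltW t0) // lef_pV2 ?posrE; lra.
apply: le_trans var _;
  rewrite lee_fin exprMn KK s2 mulrA ler_wpM2r ?powR_ge0 //.
by lra.
Qed.
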